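(* Let $\kappa:\mathbb D\to\mathbb R$ be a locally H\''older continuous function and suppose that $\lambda(z)\,|dz|$ is a conformal metric on $\mathbb D'=\mathbb D\setminus\{0\}$ with a singularity of order $1$ at $z=0$ and such that $\kappa_\lambda(z)=\kappa(z)$ for all $z\in\mathbb D'$. Then the following hold. (a) If $\kappa(0)=-4$, then $$\log\lambda(z)=\log\lambda_{\mathbb D'}(z)+O\left(\frac{1}{\log\frac1{|z|}}\right)\qquad(z\to0).$$ (b) If $\kappa_\lambda(z)\le-4$ for all $z\in\mathbb D'$ and $$\log\lambda(z_n)=\log\lambda_{\mathbb D'}(z_n)+o\left(\frac{1}{\log\frac1{|z_n|}}\right)\qquad (n\to\infty)$$ for a sequence $\{z_n\}$ in $\mathbb D'$ tending to $0$, then $\lambda=\lambda_{\mathbb D'}$ on $\mathbb D'$.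
   Context: $\mathbb D$ is the open unit disk in $\mathbb C$ and $\mathbb D'=\mathbb D\setminus\{0\}$. A conformal metric $\lambda(z)\,|dz|$ on a domain $G\subseteq\mathbb C$ is a continuous, strictly positive function $\lambda$ on $G$, assumed throughout to be of class $C^2$. Its Gauss curvature is $\kappa_\lambda(z)=-\Delta(\log\lambda)(z)/\lambda(z)^2$. The metric $\lambda(z)\,|dz|$ on $\mathbb D'$ has a singularity of order $1$ (a logarithmic singularity) at $z=0$ if there is a continuous function $v:\mathbb D\to\mathbb R$ such that $$\log\lambda(z)=-\log|z|-\log\log(1/|z|)+v(z)\quad\text{for } z\in\mathbb D'.$$ $\lambda_{\mathbb D'}(z)\,|dz|$ is the hyperbolic metric of $\mathbb D'$ with constant curvature $-4$, explicitly $\lambda_{\mathbb D'}(z)=\dfrac{1}{2|z|\log\frac1{|z|}}$. *)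

(* Defs.v *)
From Stdlib Require Import Reals.
From Coquelicot Require Import Coquelicot.
Open Scope R_scope.

(* Functions on a domain G of the plane are total functions C -> R, about which
   only the values at points of the open set G are ever used: continuity and
   derivatives at a point of G depend on the values near that point only. *)

Definition unit_disk (z : C) : Prop := Cmod z < 1.

Definition punctured_disk (z : C) : Prop := unit_disk z /\ z <> RtoC 0.

Definition ex_dx (f : C -> R) (z : C) : Prop :=
  ex_derive (fun t : R => f (t, snd z)) (fst z).

Definition ex_dy (f : C -> R) (z : C) : Prop :=
  ex_derive (fun t : R => f (fst z, t)) (snd z).

Definition dx (f : C -> R) (z : C) : R :=
  Derive (fun t : R => f (t, snd z)) (fst z).

Definition dy (f : C -> R) (z : C) : R :=
  Derive (fun t : R => f (fst z, t)) (snd z).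

Definition laplacian (f : C -> R) (z : C) : R := dx (dx f) z + dy (dy f) z.

Definition continuous_on_set (G : C -> Prop) (f : C -> R) : Prop :=
  forall z : C, G z -> continuous f z.

Definition C1_on (G : C -> Prop) (f : C -> R) : Prop :=
  (forall z : C, G z -> ex_dx f z /\ ex_dy f z) /\
  continuous_on_set G f /\
  continuous_on_set G (dx f) /\
  continuous_on_set G (dy f).

Definition C2_on (G : C -> Prop) (f : C -> R) : Prop :=
  C1_on G f /\ C1_on G (dx f) /\ C1_on G (dy f).

Definition conformal_metric (G : C -> Prop) (lambda : C -> R) : Prop :=
  C2_on G lambda /\ forall z : C, G z -> 0 < lambda z.

Definition gauss_curvature (lambda : C -> R) (z : C) : R :=
  - laplacian (fun w : C => ln (lambda w)) z / (lambda z) ^ 2.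

(* The exponent and the constant may depend on the point.  The case z = w is
   excluded because Rpower 0 alpha = 1 in the standard library. *)
Definition locally_holder (G : C -> Prop) (f : C -> R) : Prop :=
  forall z0 : C, G z0 ->
  exists alpha M delta : R,
    0 < alpha <= 1 /\ 0 < delta /\
    forall z w : C,
      G z -> G w -> Cmod (z - z0) < delta -> Cmod (w - z0) < delta ->
      z <> w -> Rabs (f z - f w) <= M * Rpower (Cmod (z - w)) alpha.

Definition singularity_of_order_1 (lambda : C -> R) : Prop :=
  exists v : C -> R,
    continuous_on_set unit_disk v /\
    forall z : C, punctured_disk z ->
      ln (lambda z) = - ln (Cmod z) - ln (ln (1 / Cmod z)) + v z.

Definition hyperbolic_punctured_disk (z : C) : R :=
  1 / (2 * Cmod z * ln (1 / Cmod z)).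

(* f = O(g) along the filter F. *)
Definition is_bigO {T : Type} (F : (T -> Prop) -> Prop) (f g : T -> R) : Prop :=
  exists M : R, F (fun x : T => Rabs (f x) <= M * Rabs (g x)).

(* f = o(g) along the filter F; in Coquelicot's is_domin the dominating
   function comes first. *)
Definition is_littleo {T : Type} (F : (T -> Prop) -> Prop) (f g : T -> R) : Prop :=
  is_domin F g f.

(* Main.v *)
Require Import Defs.
From Stdlib Require Import Reals Lra Psatz Classical ClassicalEpsilon.
From Coquelicot Require Import Coquelicot.
Open Scope R_scope.

(** Write [ell z = log (1 / |z|)] and let [w] be the logarithm of the quotient of
    [lambda] by the hyperbolic metric of the punctured disk ([log_ratio]).  With
    [k = - kappa / 4] the curvature equation becomes
      [|z|^2 ell^2 Laplacian w = k exp (2 w) - 1],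
    and the hypothesis on the singularity says that [w] has a finite limit at [0].
    Everything follows by comparing [w] with explicit functions [g] of [ell].  As
    [ell] is harmonic with gradient of length [1 / |z|], the quantity
    [|z|^2 Laplacian (g o ell)] is just [g'' o ell], and at a positive maximum of
    [w - g o ell] the Laplacian of this difference cannot be positive
    ([radial_comparison]).

    (a) If [k] tends to [1], the limit of [w] is [0]: otherwise [Laplacian w] or its
    opposite exceeds a multiple of [1 / (|z| ell)^2], the Laplacian of [- log ell],
    and [w] would be unbounded ([limit_is_zero]).  The linearised equation
    [g'' = 2 g / s^2] has the decaying solution [1 / s], and small quadratic effects
    turn multiples of it into barriers on both sides, the Hoelder condition making
    [k - 1] exponentially small in [ell]; so [w = O (1 / ell)]
    ([decay_of_log_ratio]).

    (b) Along the sequence [w] tends to [0], so its limit is [0].  Since [k >= 1], the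
    hyperbolic metrics of smaller punctured disks dominate [lambda], and [w <= 0]
    follows ([log_ratio_nonpositive]).  If [w] were negative at one point it would be
    negative on the whole circle through it, by the strong maximum principle
    ([negativity_spreads_over_circle]), and comparison with the same solution
    [- A / ell] of the linearised equation would give [w <= - A / ell] near [0] with
    [A > 0] ([negative_log_ratio_decay]).  This contradicts [w = o (1 / ell)] along
    the sequence. *)

(** * Maxima of continuous functions in the plane *)

Lemma continuous_bounded_above_nearby (F : C -> R) (p : C) (m : R) :
  continuous F p -> F p < m -> locally p (fun q => F q < m).
Proof.
intros HF Hm.
exact (HF (fun y => y < m) (open_lt m (F p) Hm)).
Qed.

Lemma continuous_bounded_below_nearby (F : C -> R) (p : C) (m : R) :
  continuous F p -> m < F p -> locally p (fun q => m < F q).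
Proof.
intros HF Hm.
exact (HF (fun y => m < y) (open_gt m (F p) Hm)).
Qed.

(** The supremum is taken of [atan o F], which is bounded whatever [F] is.  Were it
    not attained, every point would have a neighbourhood of some size [d] on which
    the function stays below the supremum minus the same [d]; a lower bound of the
    sizes over a square then contradicts the choice of the supremum. *)
Lemma continuous_attains_max (K : C -> Prop) (F : C -> R) (b : R) :
  (forall p, ~ K p -> locally p (fun q => ~ K q)) ->
  (forall p, K p -> Rabs (fst p) <= b /\ Rabs (snd p) <= b) ->
  (forall p, K p -> continuous F p) ->
  (exists p, K p) ->
  exists p, K p /\ forall q, K q -> F q <= F p.
Proof.
intros Hclosed Hbound Hcont [p0 Hp0].
apply NNPP; intros Hno.
set (E := fun y => exists p, K p /\ y = atan (F p)).
destruct (completeness E) as [S [HSub HSleast]].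
{ exists (PI / 2); intros y [p [_ ->]]; left; apply atan_bound. }
{ exists (atan (F p0)), p0; auto. }
assert (Hlt : forall p, K p -> atan (F p) < S).
{ intros p Hp.
  destruct (Rle_lt_or_eq_dec (atan (F p)) S) as [H|H]; auto.
  { apply HSub; exists p; auto. }
  exfalso; apply Hno; exists p; split; auto.
  intros q Hq; apply Rnot_lt_le; intros Hpq.
  apply atan_increasing in Hpq.
  assert (atan (F q) <= S) by (apply HSub; exists q; auto).
  lra. }
assert (Hloc : forall u v : R, exists d : posreal, forall q : C,
   Rabs (fst q - u) < d -> Rabs (snd q - v) < d -> K q -> atan (F q) < S - d).
{ intros u v.
  destruct (classic (K (u, v))) as [HK|HK].
  - pose proof (Hlt _ HK) as H1.
    assert (Hc : continuous (fun q => atan (F q)) ((u, v) : C)).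
    { apply (continuous_comp F atan); [now apply Hcont|].
      apply continuity_pt_filterlim, derivable_continuous_pt, derivable_pt_atan. }
    assert (H2 : atan (F (u, v)) < (atan (F (u, v)) + S) / 2) by lra.
    destruct (continuous_bounded_above_nearby _ _ _ Hc H2) as [d Hd].
    assert (H3 : 0 < Rmin d ((S - atan (F (u, v))) / 2)).
    { apply Rmin_pos; [apply cond_pos | lra]. }
    exists (mkposreal _ H3); simpl; intros q Hq1 Hq2 _.
    pose proof (Rmin_l d ((S - atan (F (u, v))) / 2)).
    pose proof (Rmin_r d ((S - atan (F (u, v))) / 2)).
    assert (atan (F q) < (atan (F (u, v)) + S) / 2).
    { apply Hd; split; [change (Rabs (fst q - u) < d) | change (Rabs (snd q - v) < d)]; lra. }
    lra.
  - destruct (Hclosed _ HK) as [d Hd].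
    exists d; intros q Hq1 Hq2 HKq; exfalso; revert HKq.
    apply Hd; split; [exact Hq1 | exact Hq2]. }
set (delta := fun u v => proj1_sig (constructive_indefinite_description _ (Hloc u v))).
assert (Hdelta : forall u v (q : C), Rabs (fst q - u) < delta u v ->
  Rabs (snd q - v) < delta u v -> K q -> atan (F q) < S - delta u v).
{ intros u v; unfold delta.
  exact (proj2_sig (constructive_indefinite_description _ (Hloc u v))). }
destruct (compactness_value_2d (-b) b (-b) b delta) as [d Hd].
assert (S <= S - d).
{ apply HSleast; intros y [p [Hp ->]].
  apply Rnot_lt_le; intros Hy.
  destruct (Hbound _ Hp) as [Hb1 Hb2].
  apply (Hd (fst p) (snd p)); try now apply Rabs_le_between.
  intros (u & v & _ & _ & Hu & Hv & Huv).
  pose proof (Hdelta u v p Hu Hv Hp); lra. }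
pose proof (cond_pos d); lra.
Qed.

(** * Second derivatives, Laplacians and the weak maximum principle *)

(** Stated as a relation, so that sums and compositions carry their own
    differentiability along. *)
Definition is_derive2 (f : R -> R) (t a : R) : Prop :=
  exists f' : R -> R, locally t (fun s => is_derive f s (f' s)) /\ is_derive f' t a.

Definition is_laplacian (f : C -> R) (z : C) (l : R) : Prop :=
  exists a b : R,
    is_derive2 (fun t => f (t, snd z)) (fst z) a /\
    is_derive2 (fun t => f (fst z, t)) (snd z) b /\ l = a + b.

Lemma is_derive2_ext_loc (f g : R -> R) (t a : R) :
  locally t (fun s => f s = g s) -> is_derive2 f t a -> is_derive2 g t a.
Proof.
intros H [f' [H1 H2]]; exists f'; split; auto.
generalize (filter_and _ _ (locally_locally _ _ H) H1).
apply filter_imp; intros s [Hs1 Hs2].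
exact (is_derive_ext_loc _ _ _ _ Hs1 Hs2).
Qed.

Lemma is_derive2_plus (f g : R -> R) (t a b : R) :
  is_derive2 f t a -> is_derive2 g t b -> is_derive2 (fun s => f s + g s) t (a + b).
Proof.
intros [f' [F1 F2]] [g' [G1 G2]].
exists (fun s => f' s + g' s); split; [|now apply (is_derive_plus f' g')].
generalize (filter_and _ _ F1 G1); apply filter_imp; intros s [Hf Hg].
now apply (is_derive_plus f g).
Qed.

Lemma is_derive2_scal (c : R) (f : R -> R) (t a : R) :
  is_derive2 f t a -> is_derive2 (fun s => c * f s) t (c * a).
Proof.
intros [f' [F1 F2]].
exists (fun s => c * f' s); split; [|now apply (is_derive_scal f')].
revert F1; apply filter_imp; intros s Hf; now apply (is_derive_scal f).
Qed.

Lemma is_derive2_const (c t : R) : is_derive2 (fun _ => c) t 0.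
Proof.
exists (fun _ => 0); split; [|apply (is_derive_const (0 : R))].
apply filter_forall; intros s; apply (is_derive_const (c : R)).
Qed.

Lemma is_laplacian_plus (f g : C -> R) (z : C) (k l : R) :
  is_laplacian f z k -> is_laplacian g z l ->
  is_laplacian (fun w => f w + g w) z (k + l).
Proof.
intros (a & b & Ha & Hb & ->) (a' & b' & Ha' & Hb' & ->).
exists (a + a'), (b + b'); repeat split; try ring.
- exact (is_derive2_plus (fun t => f (t, snd z)) (fun t => g (t, snd z)) _ _ _ Ha Ha').
- exact (is_derive2_plus (fun t => f (fst z, t)) (fun t => g (fst z, t)) _ _ _ Hb Hb').
Qed.

Lemma is_laplacian_scal (c : R) (f : C -> R) (z : C) (l : R) :
  is_laplacian f z l -> is_laplacian (fun w => c * f w) z (c * l).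
Proof.
intros (a & b & Ha & Hb & ->).
exists (c * a), (c * b); repeat split; try ring.
- exact (is_derive2_scal c (fun t => f (t, snd z)) _ _ Ha).
- exact (is_derive2_scal c (fun t => f (fst z, t)) _ _ Hb).
Qed.

Lemma is_laplacian_const (c : R) (z : C) : is_laplacian (fun _ => c) z 0.
Proof.
exists 0, 0; repeat split; try ring; apply is_derive2_const.
Qed.

Lemma locally_fst_line (z : C) (P : C -> Prop) :
  locally z P -> locally (fst z) (fun t => P (t, snd z)).
Proof.
intros [d Hd]; exists d; intros t Ht; apply Hd; split; [exact Ht | apply ball_center].
Qed.

Lemma locally_snd_line (z : C) (P : C -> Prop) :
  locally z P -> locally (snd z) (fun t => P (fst z, t)).
Proof.
intros [d Hd]; exists d; intros t Ht; apply Hd; split; [apply ball_center | exact Ht].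
Qed.

Lemma is_laplacian_ext_loc (f g : C -> R) (z : C) (l : R) :
  locally z (fun w => f w = g w) -> is_laplacian f z l -> is_laplacian g z l.
Proof.
intros H (a & b & Ha & Hb & ->); exists a, b; repeat split.
- revert Ha; apply is_derive2_ext_loc.
  apply (locally_fst_line z (fun w => f w = g w) H).
- revert Hb; apply is_derive2_ext_loc.
  apply (locally_snd_line z (fun w => f w = g w) H).
Qed.

Lemma is_laplacian_opp (f : C -> R) (z : C) (l : R) :
  is_laplacian f z l -> is_laplacian (fun w => - f w) z (- l).
Proof.
intros Hf; replace (- l) with (-1 * l) by ring.
apply is_laplacian_ext_loc with (fun w => -1 * f w); [|now apply is_laplacian_scal].
apply filter_forall; intros w; ring.
Qed.

Lemma is_laplacian_minus (f g : C -> R) (z : C) (k l : R) :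
  is_laplacian f z k -> is_laplacian g z l ->
  is_laplacian (fun w => f w - g w) z (k - l).
Proof.
intros Hf Hg; exact (is_laplacian_plus f (fun w => - g w) z k (- l) Hf (is_laplacian_opp _ _ _ Hg)).
Qed.

Lemma is_derive2_le_0_at_local_max (f : R -> R) (t a : R) :
  is_derive2 f t a -> locally t (fun s => f s <= f t) -> a <= 0.
Proof.
intros [f' [[d1 H1] H2]] [d2 Hmax].
apply Rnot_lt_le; intros Ha.
assert (Hd1 := cond_pos d1); assert (Hd2 := cond_pos d2).
assert (H0 : f' t = 0).
{ assert (Hd : derivable_pt_lim f t (f' t)).
  { apply is_derive_Reals, H1, ball_center. }
  pose (pr := exist _ (f' t) Hd : derivable_pt f t).
  change (f' t) with (derive_pt f t pr).
  apply (deriv_maximum f (t - d2) (t + d2)); try lra.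
  intros x Hx1 Hx2; apply Hmax; apply Rabs_def1; simpl; unfold minus, plus, opp; simpl; lra. }
assert (Hq : locally' t (fun s => 0 < (f' s - f' t) / (s - t))).
{ apply is_derive_Reals in H2.
  destruct (H2 (a / 2)) as [d Hd]; [lra|].
  exists d; intros s Hs Hst.
  assert (Hst' : s - t <> 0) by lra.
  specialize (Hd (s - t) Hst' Hs).
replace (t + (s - t)) with s in Hd by (symmetry; apply Rplus_minus).
  apply Rabs_def2 in Hd; lra. }
destruct Hq as [d3 Hd3]; assert (Hd3' := cond_pos d3).
set (e := Rmin d1 (Rmin d2 d3) / 2).
assert (He : 0 < e /\ e < d1 /\ e < d2 /\ e < d3).
{ unfold e; assert (0 < Rmin d1 (Rmin d2 d3)) by (repeat apply Rmin_pos; auto).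
  pose proof (Rmin_l d1 (Rmin d2 d3)); pose proof (Rmin_r d1 (Rmin d2 d3)).
  pose proof (Rmin_l d2 d3); pose proof (Rmin_r d2 d3); lra. }
assert (Hball : forall s (d : R), t <= s <= t + e -> e < d -> Rabs (s - t) < d).
{ intros s d Hs Hed; rewrite Rabs_pos_eq; lra. }
destruct (MVT_cor2 f f' t (t + e)) as [c [Hc1 Hc2]]; [lra| |].
{ intros c Hc; apply is_derive_Reals, H1; apply (Hball c d1); lra. }
assert (Hc : 0 < (f' c - f' t) / (c - t)).
{ apply Hd3; [apply (Hball c d3); lra | lra]. }
assert (Hpos : 0 < f' c).
{ replace (f' c) with ((f' c - f' t) / (c - t) * (c - t)).
  - apply Rmult_lt_0_compat; lra.
  - rewrite H0; field; lra. }
assert (f (t + e) <= f t) by (apply Hmax; apply (Hball (t + e) d2); lra).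
assert (0 < f' c * (t + e - t)) by (apply Rmult_lt_0_compat; lra).
lra.
Qed.

(** At an interior maximum both pure second derivatives, hence the Laplacian, are
    at most [0]; the last hypothesis therefore excludes a positive maximum. *)
Lemma weak_maximum_principle (K : C -> Prop) (F : C -> R) (b : R) :
  (forall p, ~ K p -> locally p (fun q => ~ K q)) ->
  (forall p, K p -> Rabs (fst p) <= b /\ Rabs (snd p) <= b) ->
  (forall p, K p -> continuous F p) ->
  (forall p, K p -> 0 < F p ->
     locally p K /\ exists l, is_laplacian F p l /\ 0 < l) ->
  forall p, K p -> F p <= 0.
Proof.
intros Hclosed Hbound Hcont Hlap p Hp.
destruct (continuous_attains_max K F b Hclosed Hbound Hcont (ex_intro _ p Hp))
  as [m [Hm Hmax]].
apply Rnot_lt_le; intros HFp.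
assert (HFm : 0 < F m) by (specialize (Hmax p Hp); lra).
destruct (Hlap m Hm HFm) as [Hint [l [(a1 & a2 & H1 & H2 & ->) Hl]]].
assert (Hloc : locally m (fun q => F q <= F m)).
{ revert Hint; apply filter_imp; intros q Hq; auto. }
assert (a1 <= 0).
{ apply (is_derive2_le_0_at_local_max _ _ _ H1); destruct m as [mx my].
  exact (locally_fst_line (mx, my) _ Hloc). }
assert (a2 <= 0).
{ apply (is_derive2_le_0_at_local_max _ _ _ H2); destruct m as [mx my].
  exact (locally_snd_line (mx, my) _ Hloc). }
lra.
Qed.

(** * The modulus and its logarithm *)

Definition ell (z : C) : R := ln (1 / Cmod z).

Lemma Cmod_sqr (z : C) : Cmod z ^ 2 = fst z ^ 2 + snd z ^ 2.
Proof.
unfold Cmod; apply pow2_sqrt; nra.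
Qed.

Lemma continuous_fst_C (z : C) : continuous (fun w : C => fst w) z.
Proof. destruct z as [x y]; apply (continuous_fst (U := R_UniformSpace) (V := R_UniformSpace)). Qed.

Lemma continuous_snd_C (z : C) : continuous (fun w : C => snd w) z.
Proof. destruct z as [x y]; apply (continuous_snd (U := R_UniformSpace) (V := R_UniformSpace)). Qed.

Lemma continuous_real_comp (f : C -> R) (h : R -> R) (h' : R) (z : C) :
  continuous f z -> is_derive h (f z) h' -> continuous (fun w => h (f w)) z.
Proof.
intros Hf Hh; apply (continuous_comp f h); [exact Hf|].
apply (ex_derive_continuous h); exists h'; exact Hh.
Qed.

Lemma continuous_Cmod (z : C) : continuous (fun w : C => Cmod w) z.
Proof.
unfold Cmod; apply (continuous_comp (fun w : C => fst w ^ 2 + snd w ^ 2) sqrt).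
- apply (continuous_plus (fun w : C => fst w ^ 2) (fun w : C => snd w ^ 2)).
  + apply (continuous_real_comp (fun w => fst w) (fun t => t ^ 2) (2 * fst z)).
    * apply continuous_fst_C.
    * auto_derive; auto; ring.
  + apply (continuous_real_comp (fun w => snd w) (fun t => t ^ 2) (2 * snd z)).
    * apply continuous_snd_C.
    * auto_derive; auto; ring.
- apply continuity_pt_filterlim, continuity_pt_sqrt; nra.
Qed.

Lemma locally_Cmod_between (a b : R) (z : C) :
  a < Cmod z < b -> locally z (fun w : C => a < Cmod w < b).
Proof.
intros [Ha Hb]; apply filter_and.
- apply continuous_bounded_below_nearby; [apply continuous_Cmod | exact Ha].
- apply continuous_bounded_above_nearby; [apply continuous_Cmod | exact Hb].
Qed.

Lemma annulus_closed (a b : R) (p : C) :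
  ~ a <= Cmod p <= b -> locally p (fun q : C => ~ a <= Cmod q <= b).
Proof.
intros Hp; destruct (Rlt_or_le (Cmod p) a) as [H|H].
- assert (H' : Cmod p - 1 < Cmod p < a) by lra.
  generalize (locally_Cmod_between _ _ _ H'); apply filter_imp; intros q Hq; lra.
- assert (H' : b < Cmod p < Cmod p + 1) by (split; [apply Rnot_le_lt; tauto | lra]).
  generalize (locally_Cmod_between _ _ _ H'); apply filter_imp; intros q Hq; lra.
Qed.

Lemma coordinates_le_Cmod (p : C) : Rabs (fst p) <= Cmod p /\ Rabs (snd p) <= Cmod p.
Proof.
split; apply Rle_trans with (2 := Rmax_Cmod p); [apply Rmax_l | apply Rmax_r].
Qed.

Lemma punctured_disk_Cmod (z : C) : punctured_disk z <-> 0 < Cmod z < 1.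
Proof.
unfold punctured_disk, unit_disk; split; intros [H1 H2]; split; auto.
- now apply Cmod_gt_0.
- now apply Cmod_gt_0.
Qed.

Lemma locally_punctured_disk (z : C) : punctured_disk z -> locally z punctured_disk.
Proof.
intros Hz; apply punctured_disk_Cmod, locally_Cmod_between in Hz; revert Hz.
apply filter_imp; intros w Hw; now apply punctured_disk_Cmod.
Qed.

Lemma ell_opp_ln (z : C) : 0 < Cmod z -> ell z = - ln (Cmod z).
Proof.
intros Hz; unfold ell, Rdiv; rewrite Rmult_1_l; now apply ln_Rinv.
Qed.

Lemma ell_of_coordinates (z : C) :
  0 < Cmod z -> ell z = - ln (fst z ^ 2 + snd z ^ 2) / 2.
Proof.
intros Hz; rewrite ell_opp_ln, <- Cmod_sqr by auto.
rewrite ln_pow by auto; simpl; field.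
Qed.

Lemma ln_inv_pos (x : R) : 0 < x < 1 -> 0 < ln (1 / x).
Proof.
intros Hx; unfold Rdiv; rewrite Rmult_1_l, ln_Rinv by tauto.
assert (ln x < ln 1) by (apply ln_increasing; lra).
rewrite ln_1 in H; lra.
Qed.

Lemma ell_pos (z : C) : 0 < Cmod z < 1 -> 0 < ell z.
Proof. apply ln_inv_pos. Qed.

Lemma ell_lt (z : C) (r : R) : 0 < Cmod z < r -> ln (1 / r) < ell z.
Proof.
intros Hz; unfold ell; apply ln_increasing; unfold Rdiv; rewrite !Rmult_1_l.
- apply Rinv_0_lt_compat; lra.
- apply Rinv_lt_contravar; nra.
Qed.

Lemma ell_le (z : C) (r : R) : 0 < Cmod z <= r -> ln (1 / r) <= ell z.
Proof.
intros [H1 [H2| <-]]; [left; apply ell_lt; lra | unfold ell; lra].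
Qed.

Lemma exp_opp_ell (z : C) : 0 < Cmod z -> exp (- ell z) = Cmod z.
Proof.
intros Hz; rewrite ell_opp_ln, Ropp_involutive by auto; now apply exp_ln.
Qed.

Lemma Cmod_le_of_ell (z : C) (s : R) : 0 < Cmod z <= exp (- s) -> s <= ell z.
Proof.
intros Hz; replace s with (ln (1 / exp (- s))); [now apply ell_le|].
unfold Rdiv; rewrite Rmult_1_l, <- exp_Ropp, ln_exp; ring.
Qed.

Lemma continuous_ell (z : C) : 0 < Cmod z -> continuous ell z.
Proof.
intros Hz.
apply (continuous_real_comp Cmod (fun t => ln (1 / t)) (- / Cmod z)).
- apply continuous_Cmod.
- assert (0 < / Cmod z) by now apply Rinv_0_lt_compat.
  auto_derive; [split; lra | field; lra].
Qed.

(** * Comparison with functions of [log (1 / |z|)] *)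

Lemma second_derivative_along_line (g g' : R -> R) (g2 x b : R) :
  0 < x ^ 2 + b ^ 2 ->
  locally (- ln (x ^ 2 + b ^ 2) / 2) (fun s => is_derive g s (g' s)) ->
  is_derive g' (- ln (x ^ 2 + b ^ 2) / 2) g2 ->
  is_derive2 (fun t => g (- ln (t ^ 2 + b ^ 2) / 2)) x
    (g2 * x ^ 2 / (x ^ 2 + b ^ 2) ^ 2 +
     g' (- ln (x ^ 2 + b ^ 2) / 2) *
       (2 * x ^ 2 / (x ^ 2 + b ^ 2) ^ 2 - 1 / (x ^ 2 + b ^ 2))).
Proof.
intros Hq Hg Hg'.
set (m := fun t => - ln (t ^ 2 + b ^ 2) / 2).
assert (Hm : forall t, 0 < t ^ 2 + b ^ 2 -> is_derive m t (- t / (t ^ 2 + b ^ 2))).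
{ intros t Ht; unfold m; auto_derive; [lra | field; lra]. }
assert (Hloc : locally x (fun t => 0 < t ^ 2 + b ^ 2)).
{ assert (Hc : continuous (fun t => t ^ 2 + b ^ 2) x).
  { apply (ex_derive_continuous (fun t => t ^ 2 + b ^ 2)); auto_derive; auto. }
  exact (Hc _ (open_gt 0 _ Hq)). }
exists (fun t => g' (m t) * (- t / (t ^ 2 + b ^ 2))); split.
- assert (Hmc : continuous m x).
  { apply (ex_derive_continuous m); eexists; now apply Hm. }
  generalize (filter_and _ _ Hloc (Hmc _ Hg)); apply filter_imp; intros t [Ht1 Ht2].
  rewrite Rmult_comm.
  apply (is_derive_comp g m t _ _ Ht2 (Hm t Ht1)).
- assert (H1 := is_derive_comp g' m x _ _ Hg' (Hm x Hq)).
  assert (H2 : is_derive (fun t => - t / (t ^ 2 + b ^ 2)) x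
     (2 * x ^ 2 / (x ^ 2 + b ^ 2) ^ 2 - 1 / (x ^ 2 + b ^ 2))).
  { auto_derive; [lra | field; lra]. }
  assert (H3 := is_derive_mult _ _ _ _ _ H1 H2 Rmult_comm).
  eapply is_derive_ext; [|eapply eq_rect; [exact H3|]].
  + intros t; reflexivity.
  + unfold scal, plus, mult; simpl; unfold mult, m; simpl; field; lra.
Qed.

(** [ell] is harmonic with gradient of length [1 / |z|], so only the second
    derivative of [g] survives in the Laplacian of [g o ell]. *)
Lemma laplacian_of_radial (g g' : R -> R) (g2 : R) (z : C) :
  0 < Cmod z ->
  locally (ell z) (fun s => is_derive g s (g' s)) ->
  is_derive g' (ell z) g2 ->
  is_laplacian (fun w => g (ell w)) z (g2 / Cmod z ^ 2).
Proof.
intros Hz Hg Hg'.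
assert (Hq : 0 < fst z ^ 2 + snd z ^ 2) by (rewrite <- Cmod_sqr; nra).
apply is_laplacian_ext_loc with (fun w => g (- ln (fst w ^ 2 + snd w ^ 2) / 2)).
{ generalize (locally_Cmod_between 0 (Cmod z + 1) z (conj Hz (Rlt_plus_1 _))).
  apply filter_imp; intros w [Hw _]; now rewrite ell_of_coordinates. }
rewrite ell_of_coordinates in Hg, Hg' by auto.
eexists; eexists; repeat split.
- apply (second_derivative_along_line g g' g2 (fst z) (snd z) Hq Hg Hg').
- apply is_derive2_ext_loc with (fun t => g (- ln (t ^ 2 + fst z ^ 2) / 2)).
  { apply filter_forall; intros t; simpl fst; simpl snd; now rewrite (Rplus_comm (t ^ 2)). }
  rewrite Rplus_comm in Hq; rewrite Rplus_comm in Hg; rewrite Rplus_comm in Hg'.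
  apply (second_derivative_along_line g g' g2 (snd z) (fst z) Hq Hg Hg').
- rewrite Cmod_sqr, (Rplus_comm (snd z ^ 2)); field; lra.
Qed.

(** Where [w] exceeds the barrier the difference is strictly subharmonic, so it has
    no positive maximum; the condition at the puncture replaces a boundary value
    there, and lets the maximum principle be used on annuli only. *)
Lemma radial_comparison (w Lw : C -> R) (g g' g'' : R -> R) (r : R) :
  0 < r ->
  (forall z : C, 0 < Cmod z <= r -> continuous w z) ->
  (forall z : C, 0 < Cmod z < r -> is_laplacian w z (Lw z)) ->
  (forall s, ln (1 / r) <= s -> is_derive g s (g' s)) ->
  (forall s, ln (1 / r) < s -> is_derive g' s (g'' s)) ->
  (forall eps, 0 < eps -> exists eta, 0 < eta /\
     forall z : C, 0 < Cmod z <= eta -> w z - g (ell z) <= eps) ->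
  (forall z : C, Cmod z = r -> w z <= g (ell z)) ->
  (forall z : C, 0 < Cmod z < r -> g (ell z) < w z ->
     g'' (ell z) < Cmod z ^ 2 * Lw z) ->
  forall z : C, 0 < Cmod z <= r -> w z <= g (ell z).
Proof.
intros Hr Hwc Hwl Hg1 Hg2 Hpunct Hbd Hsub z Hz.
apply Rnot_lt_le; intros Hneg.
set (eps := (w z - g (ell z)) / 2).
assert (Heps : 0 < eps) by (unfold eps; lra).
destruct (Hpunct eps Heps) as [eta [Heta Hsmall]].
set (eta' := Rmin eta (Cmod z)).
assert (Heta' : 0 < eta' /\ eta' <= eta /\ eta' <= Cmod z).
{ unfold eta'; split; [apply Rmin_pos; tauto | split; [apply Rmin_l | apply Rmin_r]]. }
enough (w z - g (ell z) - eps <= 0) by (unfold eps in *; lra).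
assert (Hgc : forall p : C, 0 < Cmod p <= r -> continuous (fun q => g (ell q)) p).
{ intros p Hp; apply (continuous_real_comp ell g (g' (ell p))).
  - now apply continuous_ell.
  - now apply Hg1, ell_le. }
apply (weak_maximum_principle (fun p => eta' <= Cmod p <= r)
         (fun p => w p - g (ell p) - eps) r); [| | | | lra].
- apply annulus_closed.
- intros p Hp; pose proof (coordinates_le_Cmod p); lra.
- intros p Hp.
  apply (continuous_minus (fun q => w q - g (ell q)) (fun _ => eps));
    [|apply continuous_const].
  apply (continuous_minus w (fun q => g (ell q))); [apply Hwc | apply Hgc]; lra.
- intros p Hp HFp.
  assert (H1 : Cmod p <> r).
  { intros H; specialize (Hbd p H); lra. }
  assert (H2 : eta' < Cmod p).
  { apply Rnot_le_lt; intros H; specialize (Hsmall p); lra. }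
  assert (H3 : 0 < Cmod p < r) by lra.
  split.
  { assert (H4 : eta' < Cmod p < r) by lra.
    generalize (locally_Cmod_between _ _ _ H4); apply filter_imp; intros q Hq; lra. }
  assert (H5 := ell_lt p r H3).
  exists (Lw p - g'' (ell p) / Cmod p ^ 2 - 0); split.
  + apply (is_laplacian_minus (fun q => w q - g (ell q)) (fun _ => eps));
      [|apply is_laplacian_const].
    apply (is_laplacian_minus w (fun q => g (ell q))); [now apply Hwl|].
    apply laplacian_of_radial with g'; [tauto | | now apply Hg2].
    generalize (open_gt _ _ H5); apply filter_imp; intros s Hs; apply Hg1; lra.
  + assert (H6 : g'' (ell p) < Cmod p ^ 2 * Lw p) by (apply Hsub; lra).
    assert (H7 : 0 < Cmod p ^ 2) by nra.
    replace (Lw p - g'' (ell p) / Cmod p ^ 2 - 0)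
      with ((Cmod p ^ 2 * Lw p - g'' (ell p)) / Cmod p ^ 2) by (field; lra).
    apply Rdiv_lt_0_compat; lra.
Qed.

(** * The curvature equation *)

Lemma is_derive2_ln_Derive (f : R -> R) (t : R) :
  locally t (fun s => 0 < f s /\ ex_derive f s) -> ex_derive (Derive f) t ->
  is_derive2 (fun s => ln (f s)) t (Derive (Derive (fun s => ln (f s))) t).
Proof.
intros Hf Hf'.
assert (Hln : locally t (fun s => is_derive (fun s => ln (f s)) s (Derive f s / f s))).
{ revert Hf; apply filter_imp; intros s [Hs1 Hs2].
  apply (is_derive_comp ln f s (/ f s) (Derive f s)).
  - now apply is_derive_ln.
  - now apply Derive_correct. }
exists (Derive (fun s => ln (f s))); split.
- revert Hln; apply filter_imp; intros s Hs.
  apply Derive_correct; now exists (Derive f s / f s).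
- apply Derive_correct.
  apply ex_derive_ext_loc with (fun s => Derive f s / f s).
  + revert Hln; apply filter_imp; intros s Hs; symmetry; now apply is_derive_unique.
  + destruct (locally_singleton _ _ Hf) as [H1 H2].
    apply ex_derive_div; auto; lra.
Qed.

Lemma is_laplacian_ln_metric (lambda : C -> R) (z : C) :
  conformal_metric punctured_disk lambda -> punctured_disk z ->
  is_laplacian (fun w => ln (lambda w)) z (laplacian (fun w => ln (lambda w)) z).
Proof.
intros [[[HC1 _] [[Hx _] [Hy _]]] Hpos] Hz.
assert (Hloc := locally_punctured_disk z Hz).
exists (dx (dx (fun w => ln (lambda w))) z), (dy (dy (fun w => ln (lambda w))) z).
repeat split.
- apply (is_derive2_ln_Derive (fun t => lambda (t, snd z))); [|now apply Hx].
  generalize (locally_fst_line z _ Hloc); apply filter_imp; intros t Ht.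
  split; [now apply Hpos | apply (proj1 (HC1 _ Ht))].
- apply (is_derive2_ln_Derive (fun t => lambda (fst z, t))); [|now apply Hy].
  generalize (locally_snd_line z _ Hloc); apply filter_imp; intros t Ht.
  split; [now apply Hpos | apply (proj2 (HC1 _ Ht))].
Qed.

Lemma hyperbolic_pos (z : C) : 0 < Cmod z < 1 -> 0 < hyperbolic_punctured_disk z.
Proof.
intros Hz; unfold hyperbolic_punctured_disk.
assert (0 < ell z) by now apply ell_pos.
apply Rdiv_lt_0_compat; [lra|]; fold (ell z); nra.
Qed.

Lemma ln_hyperbolic (z : C) :
  0 < Cmod z < 1 ->
  ln (hyperbolic_punctured_disk z) = ell z - ln (ell z) - ln 2.
Proof.
intros Hz; assert (He := ell_pos z Hz).
unfold hyperbolic_punctured_disk; fold (ell z).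
unfold Rdiv; rewrite Rmult_1_l, ln_Rinv by (repeat apply Rmult_lt_0_compat; lra).
rewrite !ln_mult by (try apply Rmult_lt_0_compat; lra).
rewrite (ell_opp_ln z) at 2 by tauto; ring.
Qed.

Definition log_ratio (lambda : C -> R) (z : C) : R :=
  ln (lambda z) - ln (hyperbolic_punctured_disk z).

(** The curvature equation of [lambda], rewritten for the logarithm of its quotient
    by the hyperbolic metric, which is the curvature [-4] solution. *)
Lemma log_ratio_equation (lambda : C -> R) (z : C) :
  conformal_metric punctured_disk lambda -> punctured_disk z ->
  is_laplacian (log_ratio lambda) z
    ((- gauss_curvature lambda z / 4 * exp (2 * log_ratio lambda z) - 1)
       / (Cmod z ^ 2 * ell z ^ 2)).
Proof.
intros Hl Hz.
assert (Hz' := proj1 (punctured_disk_Cmod z) Hz).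
assert (He := ell_pos z Hz').
assert (Hpos : 0 < lambda z) by now apply Hl.
assert (Hhyp : is_laplacian (fun w => ell w - ln (ell w) - ln 2) z
                 (1 / ell z ^ 2 / Cmod z ^ 2)).
{ apply (laplacian_of_radial (fun s => s - ln s - ln 2) (fun s => 1 - / s)); [tauto| |].
  - generalize (open_gt 0 _ He); apply filter_imp; intros s Hs.
    auto_derive; [lra | field; lra].
  - auto_derive; [lra | field; lra]. }
assert (H := is_laplacian_minus _ _ _ _ _ (is_laplacian_ln_metric lambda z Hl Hz) Hhyp).
assert (Hval : (- gauss_curvature lambda z / 4 * exp (2 * log_ratio lambda z) - 1)
       / (Cmod z ^ 2 * ell z ^ 2) =
   laplacian (fun w => ln (lambda w)) z - 1 / ell z ^ 2 / Cmod z ^ 2).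
{ unfold log_ratio.
  replace (2 * (ln (lambda z) - ln (hyperbolic_punctured_disk z)))
    with (ln (lambda z) + ln (lambda z)
          - (ln (hyperbolic_punctured_disk z) + ln (hyperbolic_punctured_disk z))) by ring.
  unfold Rminus at 2; rewrite exp_plus, exp_Ropp, !exp_plus, !exp_ln;
    auto using hyperbolic_pos.
  unfold hyperbolic_punctured_disk, gauss_curvature; fold (ell z); field; lra. }
rewrite Hval; revert H; apply is_laplacian_ext_loc.
generalize (locally_punctured_disk z Hz); apply filter_imp; intros w Hw.
unfold log_ratio; rewrite ln_hyperbolic; auto; now apply punctured_disk_Cmod.
Qed.

Lemma continuous_log_ratio (lambda : C -> R) (z : C) :
  conformal_metric punctured_disk lambda -> punctured_disk z ->
  continuous (log_ratio lambda) z.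
Proof.
intros Hl Hz; assert (Hz' := proj1 (punctured_disk_Cmod z) Hz).
assert (He := ell_pos z Hz'); assert (Hh := hyperbolic_pos z Hz').
assert (Hpos : 0 < lambda z) by now apply Hl.
apply (continuous_minus (fun w => ln (lambda w))
         (fun w => ln (hyperbolic_punctured_disk w))).
- apply (continuous_real_comp lambda ln (/ lambda z)); [|now apply is_derive_ln].
  now apply (proj1 Hl).
- apply continuous_ext_loc with (fun w => ell w - ln (ell w) - ln 2).
  { generalize (locally_punctured_disk z Hz); apply filter_imp; intros w Hw.
    rewrite ln_hyperbolic; auto; now apply punctured_disk_Cmod. }
  apply (continuous_real_comp ell (fun s => s - ln s - ln 2) (1 - / ell z)).
  + now apply continuous_ell.
  + auto_derive; [lra | field; lra].
Qed.

(** The function [v] in the definition of the singularity is [log_ratio] less [ln 2], so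
    its continuity at the puncture is the existence of this limit. *)
Lemma log_ratio_limit (lambda : C -> R) :
  singularity_of_order_1 lambda ->
  exists c, forall eps, 0 < eps -> exists eta, 0 < eta < 1 /\
    forall z : C, 0 < Cmod z <= eta -> Rabs (log_ratio lambda z - c) <= eps.
Proof.
intros (v & Hv & Hlam); exists (v (RtoC 0) + ln 2); intros eps Heps.
assert (H0 : unit_disk (RtoC 0)) by (unfold unit_disk; rewrite Cmod_0; lra).
destruct (proj1 (filterlim_locally v _) (Hv _ H0) (mkposreal _ Heps)) as [d Hd].
assert (Hdp := cond_pos d).
assert (Hm : 0 < Rmin d 1) by (apply Rmin_pos; lra).
pose proof (Rmin_l d 1); pose proof (Rmin_r d 1).
exists (Rmin d 1 / 2); split; [lra|]; intros z Hz.
assert (Hz1 : 0 < Cmod z < 1) by lra.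
unfold log_ratio; rewrite ln_hyperbolic, Hlam by (auto; now apply punctured_disk_Cmod).
fold (ell z); rewrite (ell_opp_ln z) at 2 by tauto.
replace (- ln (Cmod z) - ln (ell z) + v z - (- ln (Cmod z) - ln (ell z) - ln 2)
   - (v (RtoC 0) + ln 2)) with (v z - v (RtoC 0)) by ring.
left; apply Hd.
pose proof (coordinates_le_Cmod z).
split; [change (Rabs (fst z - 0) < d) | change (Rabs (snd z - 0) < d)];
  rewrite Rminus_0_r; lra.
Qed.

(** * Elementary estimates *)

Lemma exp_mono (x y : R) : x <= y -> exp x <= exp y.
Proof.
intros [H| ->]; [left; now apply exp_increasing | lra].
Qed.

Lemma exp_ge_quadratic (x : R) : 0 <= x -> 1 + x + x ^ 2 / 2 <= exp x.
Proof.
intros Hx; pose proof (exp_ge_taylor x 2 Hx) as H; simpl in H.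
unfold Rdiv in *; lra.
Qed.

Lemma exp_opp_le_quadratic (x : R) : 0 <= x -> exp (- x) <= 1 - x + x ^ 2 / 2.
Proof.
intros Hx; pose proof (exp_ge_quadratic x Hx) as H.
assert (He := exp_pos (- x)).
assert (Hp : exp x * exp (- x) = 1) by (rewrite <- exp_plus, Rplus_opp_r; apply exp_0).
assert (Hq : 1 <= (1 - x + x ^ 2 / 2) * exp x).
{ apply Rle_trans with ((1 - x + x ^ 2 / 2) * (1 + x + x ^ 2 / 2)).
  - assert (0 <= (x ^ 2) ^ 2) by apply pow2_ge_0.
    replace ((1 - x + x ^ 2 / 2) * (1 + x + x ^ 2 / 2)) with (1 + (x ^ 2) ^ 2 / 4) by field; lra.
  - apply Rmult_le_compat_l; auto.
    assert (0 <= (1 - x) ^ 2) by apply pow2_ge_0; nra. }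
apply Rmult_le_reg_r with (exp x); [apply exp_pos|]; lra.
Qed.

Lemma exp_dominates_square (alpha s : R) :
  0 < alpha -> 0 <= s -> exp (- (alpha * s)) * s ^ 2 <= 4 / alpha ^ 2.
Proof.
intros Ha Hs; set (x := alpha * s).
assert (Hx : 0 <= x) by (unfold x; nra).
assert (Hp : exp x * exp (- x) = 1) by (rewrite <- exp_plus, Rplus_opp_r; apply exp_0).
assert (He := exp_pos (- x)).
assert (Hq := exp_ge_quadratic x Hx).
assert (Hx2 : exp (- x) * x ^ 2 <= 4) by nra.
apply Rmult_le_reg_r with (alpha ^ 2); [nra|].
replace (4 / alpha ^ 2 * alpha ^ 2) with 4 by (field; lra).
replace (exp (- x) * s ^ 2 * alpha ^ 2) with (exp (- x) * x ^ 2) by (unfold x; ring); lra.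
Qed.

Lemma Cmod_real_exp (s : R) : Cmod (RtoC (exp (- s))) = exp (- s).
Proof.
rewrite Cmod_R; apply Rabs_pos_eq; left; apply exp_pos.
Qed.

Lemma ell_real_exp (s : R) : ell (RtoC (exp (- s))) = s.
Proof.
rewrite ell_opp_ln; rewrite Cmod_real_exp; [|apply exp_pos].
rewrite ln_exp; ring.
Qed.

(** * The limit at the puncture and the rate of decay *)

(** Since [1 / (|z| ell)^2] is the Laplacian of [- ln ell], which is unbounded, a
    function whose Laplacian dominates a multiple of it cannot stay bounded; the
    harmonic term [eps * ell] is the usual tool to pass over the puncture. *)
Lemma no_bounded_function_with_large_laplacian (u Lu : C -> R) (r B delta : R) :
  0 < r < 1 -> 0 < delta ->
  (forall z : C, 0 < Cmod z <= r -> continuous u z) ->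
  (forall z : C, 0 < Cmod z < r -> is_laplacian u z (Lu z)) ->
  (forall z : C, 0 < Cmod z <= r -> Rabs (u z) <= B) ->
  (forall z : C, 0 < Cmod z < r -> delta / ell z ^ 2 <= Cmod z ^ 2 * Lu z) ->
  False.
Proof.
intros Hr Hdelta Huc Hul HB Hlap.
set (s0 := ln (1 / r)).
assert (Hrs : exp (- s0) = r).
{ unfold s0, Rdiv; rewrite Rmult_1_l, ln_Rinv, Ropp_involutive by lra; apply exp_ln; lra. }
assert (Hs0 : 0 < s0) by now apply ln_inv_pos.
assert (HB0 : 0 <= B).
{ apply Rle_trans with (Rabs (u (RtoC (exp (- s0))))); [apply Rabs_pos|].
  apply HB; rewrite Cmod_real_exp; lra. }
assert (Hmain : forall eps, 0 < eps -> forall z : C, 0 < Cmod z <= r ->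
   u z <= B + delta / 2 * (ln s0 - ln (ell z)) + eps * (ell z - s0)).
{ intros eps Heps.
  apply (radial_comparison u Lu
    (fun s => B + delta / 2 * (ln s0 - ln s) + eps * (s - s0))
    (fun s => - (delta / 2) / s + eps) (fun s => delta / 2 / s ^ 2) r); auto.
  - lra.
  - intros s Hs; fold s0 in Hs; auto_derive; [lra | field; lra].
  - intros s Hs; fold s0 in Hs; auto_derive; [lra | field; lra].
  - intros e He.
    set (A := delta / eps).
    assert (HA : 0 < A) by (unfold A; now apply Rdiv_lt_0_compat).
    set (S := Rmax s0 (2 / eps * (delta / 2 * (ln A - 1 - ln s0) + eps * s0))).
    exists (exp (- S)); split; [apply exp_pos|]; intros z Hz.
    assert (HS := Cmod_le_of_ell z S Hz).
    assert (HS1 : s0 <= S) by apply Rmax_l.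
    assert (HS2 : 2 / eps * (delta / 2 * (ln A - 1 - ln s0) + eps * s0) <= S) by apply Rmax_r.
    assert (Hzr : Cmod z <= r).
    { apply Rle_trans with (exp (- S)); [tauto|]; rewrite <- Hrs; apply exp_mono; lra. }
    assert (Hu := HB z (conj (proj1 Hz) Hzr)); apply Rabs_le_between in Hu.
    (* the tangent line of [ln] at [A] has slope [1 / A], half absorbed by [eps] *)
    assert (Hln : ln (ell z) <= ln A - 1 + ell z / A).
    { replace (ell z) with (A * (ell z / A)) at 1 by (field; lra).
      assert (HzA : 0 < ell z / A) by (apply Rdiv_lt_0_compat; lra).
      rewrite ln_mult by auto.
      pose proof (exp_ineq1_le (ln (ell z / A))) as H; rewrite exp_ln in H by auto; lra. }
    assert (HA2 : delta / 2 * (ell z / A) = eps / 2 * ell z) by (unfold A; field; lra).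
    assert (Hln2 : delta / 2 * ln (ell z) <= delta / 2 * (ln A - 1) + eps / 2 * ell z).
    { rewrite <- HA2, <- Rmult_plus_distr_l; apply Rmult_le_compat_l; lra. }
    assert (HS3 : delta / 2 * (ln A - 1 - ln s0) + eps * s0 <= eps / 2 * ell z).
    { replace (delta / 2 * (ln A - 1 - ln s0) + eps * s0) with
        (eps / 2 * (2 / eps * (delta / 2 * (ln A - 1 - ln s0) + eps * s0))) by (field; lra).
      apply Rmult_le_compat_l; lra. }
    lra.
  - intros z Hz; replace (ell z) with s0 by (unfold ell; rewrite Hz; reflexivity).
    assert (Hu := HB z); rewrite Hz in Hu.
    assert (Hu' := Hu ltac:(lra)); apply Rabs_le_between in Hu'; lra.
  - intros z Hz _.
    assert (He : 0 < ell z) by (apply ell_pos; lra).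
    apply Rlt_le_trans with (delta / ell z ^ 2); [|now apply Hlap].
    apply Rmult_lt_compat_r; [apply Rinv_0_lt_compat; nra | lra]. }
(* at [s = s0 exp T] the barrier with [eps = 1 / (s - s0)] has fallen below [- B] *)
set (T := 4 * (B + 1) / delta).
assert (HT : 0 < T) by (apply Rdiv_lt_0_compat; lra).
set (s := s0 * exp T).
assert (HeT : 1 + T <= exp T) by apply exp_ineq1_le.
assert (Hs : s0 < s) by (unfold s; nra).
assert (Hz : 0 < Cmod (RtoC (exp (- s))) <= r).
{ rewrite Cmod_real_exp, <- Hrs; split; [apply exp_pos | apply exp_mono; lra]. }
assert (Heps : 0 < / (s - s0)) by (apply Rinv_0_lt_compat; lra).
assert (H := Hmain _ Heps _ Hz).
rewrite ell_real_exp, Rinv_l in H by lra.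
assert (Hlns : ln s = ln s0 + T).
{ unfold s; rewrite ln_mult, ln_exp by (auto; apply exp_pos); ring. }
rewrite Hlns in H.
replace (delta / 2 * (ln s0 - (ln s0 + T))) with (- 2 * (B + 1)) in H by (unfold T; field; lra).
assert (Hu := HB _ Hz); apply Rabs_le_between in Hu; lra.
Qed.

(** If the limit were positive (negative), the right-hand side of the equation would
    be bounded below (above) by a nonzero constant over [(|z| ell)^2]. *)
Lemma limit_is_zero (w k : C -> R) (c : R) :
  (forall z : C, 0 < Cmod z < 1 -> continuous w z) ->
  (forall z : C, 0 < Cmod z < 1 ->
     is_laplacian w z ((k z * exp (2 * w z) - 1) / (Cmod z ^ 2 * ell z ^ 2))) ->
  (forall eps, 0 < eps -> exists eta, 0 < eta < 1 /\
     forall z : C, 0 < Cmod z <= eta -> Rabs (w z - c) <= eps) ->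
  (forall eps, 0 < eps -> exists eta, 0 < eta < 1 /\
     forall z : C, 0 < Cmod z <= eta -> Rabs (k z - 1) <= eps) ->
  c = 0.
Proof.
intros Hwc Hwl Hw Hk.
set (N := fun z => k z * exp (2 * w z) - 1).
assert (Hred : forall z : C, 0 < Cmod z < 1 ->
  Cmod z ^ 2 * (N z / (Cmod z ^ 2 * ell z ^ 2)) = N z / ell z ^ 2).
{ intros z Hz; assert (He := ell_pos z Hz); field; lra. }
destruct (Rtotal_order c 0) as [Hc | [Hc | Hc]]; [exfalso | exact Hc | exfalso].
- assert (Hec : 0 < exp c < 1).
  { split; [apply exp_pos | rewrite <- exp_0; now apply exp_increasing]. }
  assert (Hinv : exp (- c) * exp c = 1) by (rewrite <- exp_plus, Rplus_opp_l; apply exp_0).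
  destruct (Hw (- c / 2)) as [eta1 [He1 Hw1]]; [lra|].
  destruct (Hk ((exp (- c) - 1) / 2)) as [eta2 [He2 Hk1]]; [nra|].
  pose proof (Rmin_l eta1 eta2); pose proof (Rmin_r eta1 eta2).
  assert (0 < Rmin eta1 eta2) by (apply Rmin_pos; lra).
  apply (no_bounded_function_with_large_laplacian (fun z => - w z)
    (fun z => - (N z / (Cmod z ^ 2 * ell z ^ 2))) (Rmin eta1 eta2)
    (- 3 * c / 2) ((1 - exp c) / 2)); try lra.
  + intros z Hz; apply (continuous_opp w), Hwc; lra.
  + intros z Hz; apply is_laplacian_opp, Hwl; lra.
  + intros z Hz; assert (H2 := Hw1 z ltac:(lra)).
    apply Rabs_le_between in H2; apply Rabs_le_between; lra.
  + intros z Hz.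
    assert (H2 := Hw1 z ltac:(lra)); assert (H3 := Hk1 z ltac:(lra)).
    apply Rabs_le_between in H2; apply Rabs_le_between in H3.
    assert (He := ell_pos z ltac:(lra)).
    rewrite Ropp_mult_distr_r_reverse, Hred by lra.
    unfold Rdiv at 1 3; rewrite <- Ropp_mult_distr_l_reverse.
    apply Rmult_le_compat_r; [left; apply Rinv_0_lt_compat; nra|].
    assert (H4 : exp (2 * w z) <= exp c) by (apply exp_mono; lra).
    assert (H5 := exp_pos (2 * w z)); unfold N; nra.
- assert (Hec : 1 < exp c) by (rewrite <- exp_0; now apply exp_increasing).
  assert (Hinv : exp (- c) * exp c = 1) by (rewrite <- exp_plus, Rplus_opp_l; apply exp_0).
  assert (Hec' := exp_pos (- c)).
  destruct (Hw (c / 2)) as [eta1 [He1 Hw1]]; [lra|].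
  destruct (Hk ((1 - exp (- c)) / 2)) as [eta2 [He2 Hk1]]; [nra|].
  pose proof (Rmin_l eta1 eta2); pose proof (Rmin_r eta1 eta2).
  assert (0 < Rmin eta1 eta2) by (apply Rmin_pos; lra).
  apply (no_bounded_function_with_large_laplacian w
    (fun z => N z / (Cmod z ^ 2 * ell z ^ 2)) (Rmin eta1 eta2)
    (3 * c / 2) ((exp c - 1) / 2)); try lra.
  + intros z Hz; apply Hwc; lra.
  + intros z Hz; apply Hwl; lra.
  + intros z Hz; assert (H2 := Hw1 z ltac:(lra)).
    apply Rabs_le_between in H2; apply Rabs_le_between; lra.
  + intros z Hz.
    assert (H2 := Hw1 z ltac:(lra)); assert (H3 := Hk1 z ltac:(lra)).
    apply Rabs_le_between in H2; apply Rabs_le_between in H3.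
    assert (He := ell_pos z ltac:(lra)).
    rewrite Hred by lra; unfold Rdiv at 1 3.
    apply Rmult_le_compat_r; [left; apply Rinv_0_lt_compat; nra|].
    assert (H4 : exp c <= exp (2 * w z)) by (apply exp_mono; lra).
    unfold N; nra.
Qed.

(** The leading term [p = s0 / (2 ell)] solves the linearised equation, so the
    comparison is decided at second order: [exp (2 p)] exceeds its linear part by
    [2 p^2], which beats the exponentially small deviation of [k] from [1].  From
    below the linear barrier fails by the same [2 p^2], and [p - p^2] corrects it. *)
Lemma decay_of_log_ratio (w k : C -> R) (M alpha d : R) :
  0 < alpha -> 0 < d ->
  (forall z : C, 0 < Cmod z < 1 -> continuous w z) ->
  (forall z : C, 0 < Cmod z < 1 ->
     is_laplacian w z ((k z * exp (2 * w z) - 1) / (Cmod z ^ 2 * ell z ^ 2))) ->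
  (forall eps, 0 < eps -> exists eta, 0 < eta < 1 /\
     forall z : C, 0 < Cmod z <= eta -> Rabs (w z) <= eps) ->
  (forall z : C, 0 < Cmod z < d -> Rabs (k z - 1) <= M * exp (- (alpha * ell z))) ->
  exists A r, 0 < r < 1 /\ forall z : C, 0 < Cmod z <= r -> Rabs (w z) <= A / ell z.
Proof.
intros Ha Hd Hwc Hwl Hw Hk.
destruct (Hw (1 / 4)) as [eta [Heta Hw4]]; [lra|].
set (M' := Rmax M 0).
assert (HM : M <= M' /\ 0 <= M') by (split; [apply Rmax_l | apply Rmax_r]).
(* the last bound makes [M exp (- alpha s) <= p^2 / 4] for [s >= s0], because
   [s^2 exp (- alpha s) <= 4 / alpha^2] and [p s = s0 / (2 * s)] *)
set (s0 := 1 + Rmax (- ln eta) (Rmax (- ln d) (64 * M' / alpha ^ 2))).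
assert (Hs0 : - ln eta < s0 /\ - ln d < s0 /\ 64 * M' / alpha ^ 2 < s0 /\ 1 <= s0).
{ pose proof (Rmax_l (- ln eta) (Rmax (- ln d) (64 * M' / alpha ^ 2))).
  pose proof (Rmax_r (- ln eta) (Rmax (- ln d) (64 * M' / alpha ^ 2))).
  pose proof (Rmax_l (- ln d) (64 * M' / alpha ^ 2)).
  pose proof (Rmax_r (- ln d) (64 * M' / alpha ^ 2)).
  assert (ln eta < ln 1) by (apply ln_increasing; lra).
  rewrite ln_1 in *; unfold s0; lra. }
set (r := exp (- s0)).
assert (Hr0 : 0 < r) by apply exp_pos.
assert (Hr1 : r < 1) by (unfold r; rewrite <- exp_0; apply exp_increasing; lra).
assert (Hreta : r < eta).
{ unfold r; rewrite <- (exp_ln eta) by lra; apply exp_increasing; lra. }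
assert (Hrd : r < d).
{ unfold r; rewrite <- (exp_ln d) by lra; apply exp_increasing; lra. }
assert (Hlnr : ln (1 / r) = s0).
{ unfold Rdiv; rewrite Rmult_1_l; unfold r; rewrite <- exp_Ropp, ln_exp; ring. }
set (p := fun s => s0 / (2 * s)).
assert (Hp : forall s, s0 <= s -> 0 < p s <= 1 / 2).
{ intros s Hs; unfold p; split; [apply Rdiv_lt_0_compat; lra|].
  apply Rmult_le_reg_r with (2 * s); [lra|].
  replace (s0 / (2 * s) * (2 * s)) with s0 by (field; lra); lra. }
assert (Hkp : forall z : C, 0 < Cmod z < r -> Rabs (k z - 1) <= p (ell z) ^ 2 / 4).
{ intros z Hz; assert (Hs := ell_lt z r Hz); rewrite Hlnr in Hs.
  apply Rle_trans with (1 := Hk z ltac:(lra)).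
  apply Rle_trans with (M' * exp (- (alpha * ell z))).
  { apply Rmult_le_compat_r; [left; apply exp_pos | tauto]. }
  assert (H := exp_dominates_square alpha (ell z) Ha ltac:(lra)).
  apply Rmult_le_reg_r with (ell z ^ 2); [nra|].
  replace (p (ell z) ^ 2 / 4 * ell z ^ 2) with (s0 ^ 2 / 16) by (unfold p; field; lra).
  apply Rle_trans with (M' * (4 / alpha ^ 2)).
  { rewrite Rmult_assoc; apply Rmult_le_compat_l; tauto. }
  replace (M' * (4 / alpha ^ 2)) with (64 * M' / alpha ^ 2 / 16) by (field; lra).
  nra. }
assert (Hred : forall z : C, 0 < Cmod z < 1 -> forall N,
  Cmod z ^ 2 * (N / (Cmod z ^ 2 * ell z ^ 2)) = N / ell z ^ 2).
{ intros z Hz N; assert (He := ell_pos z Hz); field; lra. }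
exists (s0 / 2), r; split; [lra|].
assert (Hup : forall z : C, 0 < Cmod z <= r -> w z <= p (ell z)).
{ apply (radial_comparison w (fun z => (k z * exp (2 * w z) - 1) / (Cmod z ^ 2 * ell z ^ 2))
    p (fun s => - s0 / (2 * s ^ 2)) (fun s => 2 * p s / s ^ 2)); auto.
  - intros z Hz; apply Hwc; lra.
  - intros z Hz; apply Hwl; lra.
  - rewrite Hlnr; intros s Hs; unfold p; auto_derive; [lra | field; lra].
  - rewrite Hlnr; intros s Hs; unfold p; auto_derive; [nra | field; lra].
  - intros eps Heps; destruct (Hw eps Heps) as [e [He Hwe]].
    exists (Rmin e r); split; [apply Rmin_pos; lra|]; intros z Hz.
    pose proof (Rmin_l e r); pose proof (Rmin_r e r).
    assert (H1 := Hwe z ltac:(lra)); apply Rabs_le_between in H1.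
    assert (H2 := ell_le z r ltac:(lra)); rewrite Hlnr in H2.
    assert (H3 := Hp _ H2); lra.
  - intros z Hz; replace (ell z) with s0 by (rewrite <- Hlnr, <- Hz; reflexivity).
    assert (H1 := Hw4 z ltac:(lra)); apply Rabs_le_between in H1.
    unfold p; replace (s0 / (2 * s0)) with (1 / 2) by (field; lra); lra.
  - intros z Hz Hzw; rewrite Hred by lra.
    assert (Hs := ell_lt z r Hz); rewrite Hlnr in Hs.
    apply Rmult_lt_compat_r; [apply Rinv_0_lt_compat; nra|].
    assert (H1 := Hkp z Hz); apply Rabs_le_between in H1.
    assert (H2 := Hp (ell z) ltac:(lra)); set (q := p (ell z)) in *.
    assert (H3 := exp_ge_quadratic (2 * q) ltac:(lra)).
    assert (H4 : exp (2 * q) <= exp (2 * w z)) by (apply exp_mono; lra).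
    assert (H5 : (1 - q ^ 2 / 4) * (1 + 2 * q + 2 * q ^ 2) <= k z * exp (2 * w z)).
    { apply Rmult_le_compat; nra. }
    nra. }
assert (Hdn : forall z : C, 0 < Cmod z <= r -> - w z <= p (ell z) - p (ell z) ^ 2).
{ apply (radial_comparison (fun z => - w z)
    (fun z => - ((k z * exp (2 * w z) - 1) / (Cmod z ^ 2 * ell z ^ 2)))
    (fun s => p s - p s ^ 2) (fun s => - s0 / (2 * s ^ 2) + s0 ^ 2 / (2 * s ^ 3))
    (fun s => (2 * p s - 6 * p s ^ 2) / s ^ 2)); auto.
  - intros z Hz; apply (continuous_opp w), Hwc; lra.
  - intros z Hz; apply is_laplacian_opp, Hwl; lra.
  - rewrite Hlnr; intros s Hs; unfold p; auto_derive; [lra | field; lra].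
  - rewrite Hlnr; intros s Hs; unfold p.
    assert (0 < s * s) by nra; assert (0 < s * (s * s)) by nra.
    auto_derive; [split; [nra | split; [nra | auto]] | field; lra].
  - intros eps Heps; destruct (Hw eps Heps) as [e [He Hwe]].
    exists (Rmin e r); split; [apply Rmin_pos; lra|]; intros z Hz.
    pose proof (Rmin_l e r); pose proof (Rmin_r e r).
    assert (H1 := Hwe z ltac:(lra)); apply Rabs_le_between in H1.
    assert (H2 := ell_le z r ltac:(lra)); rewrite Hlnr in H2.
    assert (H3 := Hp _ H2); nra.
  - intros z Hz; replace (ell z) with s0 by (rewrite <- Hlnr, <- Hz; reflexivity).
    assert (H1 := Hw4 z ltac:(lra)); apply Rabs_le_between in H1.
    unfold p; replace (s0 / (2 * s0)) with (1 / 2) by (field; lra); lra.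
  - intros z Hz Hzw; rewrite Ropp_mult_distr_r_reverse, Hred by lra.
    assert (Hs := ell_lt z r Hz); rewrite Hlnr in Hs.
    unfold Rdiv at 2; rewrite <- Ropp_mult_distr_l_reverse.
    apply Rmult_lt_compat_r; [apply Rinv_0_lt_compat; nra|].
    assert (H1 := Hkp z Hz); apply Rabs_le_between in H1.
    assert (H2 := Hp (ell z) ltac:(lra)); set (q := p (ell z)) in *.
    set (g := q - q ^ 2) in *.
    assert (Hg : 0 <= g <= q) by (unfold g; nra).
    assert (H3 := exp_opp_le_quadratic (2 * g) ltac:(lra)).
    assert (H4 : exp (2 * w z) <= exp (- (2 * g))) by (apply exp_mono; lra).
    assert (H5 : exp (- (2 * g)) <= 1).
    { rewrite <- exp_0; apply exp_mono; lra. }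
    assert (H6 : k z * exp (2 * w z) <= exp (2 * w z) + q ^ 2 / 4).
    { pose proof (exp_pos (2 * w z)); nra. }
    assert (H7 : g ^ 2 <= q ^ 2) by nra.
    assert (H8 : 0 < q ^ 2) by nra.
    unfold g in *; nra. }
intros z Hz.
assert (Hs := ell_le z r Hz); rewrite Hlnr in Hs.
replace (s0 / 2 / ell z) with (p (ell z)) by (unfold p; field; lra).
apply Rabs_le_between; specialize (Hup z Hz); specialize (Hdn z Hz).
assert (0 <= p (ell z) ^ 2) by apply pow2_ge_0; lra.
Qed.

(** * Ahlfors' lemma *)

Lemma continuous_attains_max_on_annulus (a b : R) (F : C -> R) :
  0 < a <= b -> (forall z : C, a <= Cmod z <= b -> continuous F z) ->
  exists p : C, a <= Cmod p <= b /\ forall q : C, a <= Cmod q <= b -> F q <= F p.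
Proof.
intros Hab HF.
apply (continuous_attains_max (fun z => a <= Cmod z <= b) F b); auto.
- apply annulus_closed.
- intros p Hp; pose proof (coordinates_le_Cmod p); lra.
- exists (RtoC a); rewrite Cmod_R, Rabs_pos_eq; lra.
Qed.

Lemma bounded_above_on_punctured_disk (w : C -> R) (B0 eta rho : R) :
  0 < eta -> (forall z : C, 0 < Cmod z <= rho -> continuous w z) ->
  (forall z : C, 0 < Cmod z <= eta -> w z <= B0) ->
  exists B, forall z : C, 0 < Cmod z <= rho -> w z <= B.
Proof.
intros Heta Hw HB0.
destruct (Rle_or_lt rho eta) as [H|H].
{ exists B0; intros z Hz; apply HB0; lra. }
destruct (continuous_attains_max_on_annulus eta rho w) as [p [_ Hmax]]; [lra| |].
{ intros p Hp; apply Hw; lra. }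
exists (Rmax B0 (w p)); intros z Hz.
destruct (Rle_or_lt (Cmod z) eta) as [H1|H1].
- apply Rle_trans with (2 := Rmax_l _ _); apply HB0; lra.
- apply Rle_trans with (2 := Rmax_r _ _); apply Hmax; lra.
Qed.

(** This is Ahlfors' lemma.  The barrier [ln (s / (s - a))] is the logarithmic ratio
    of the hyperbolic metric of the punctured disk of radius [exp (- a)], which
    becomes infinite on the outer circle, so nothing need be known of [w] near the
    unit circle; then [a] tends to [0]. *)
Lemma log_ratio_nonpositive (w k : C -> R) :
  (forall z : C, 0 < Cmod z < 1 -> continuous w z) ->
  (forall z : C, 0 < Cmod z < 1 ->
     is_laplacian w z ((k z * exp (2 * w z) - 1) / (Cmod z ^ 2 * ell z ^ 2))) ->
  (forall eps, 0 < eps -> exists eta, 0 < eta < 1 /\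
     forall z : C, 0 < Cmod z <= eta -> w z <= eps) ->
  (forall z : C, 0 < Cmod z < 1 -> 1 <= k z) ->
  forall z : C, 0 < Cmod z < 1 -> w z <= 0.
Proof.
intros Hwc Hwl Hw Hk.
assert (Hmain : forall (z : C) a, 0 < Cmod z < 1 -> 0 < a < ell z ->
  w z <= ln (ell z) - ln (ell z - a)).
{ intros z a Hz Hae.
  destruct (Hw 1 ltac:(lra)) as [eta [Heta Hw1]].
  assert (Ha1 : exp (- a) < 1) by (rewrite <- exp_0; apply exp_increasing; lra).
  destruct (bounded_above_on_punctured_disk w 1 eta (exp (- a))) as [B HB]; auto; try lra.
  { intros q Hq; apply Hwc; lra. }
  (* on the circle [ell = a + t] the barrier is at least [ln (a / t)], hence at least [B] *)
  set (t := Rmin (a * exp (- B)) (ell z - a)).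
  assert (Ht : 0 < t /\ t <= a * exp (- B) /\ t <= ell z - a).
  { unfold t; split; [|split; [apply Rmin_l | apply Rmin_r]].
    apply Rmin_pos; [apply Rmult_lt_0_compat; [lra | apply exp_pos] | lra]. }
  set (r := exp (- (a + t))).
  assert (Hr0 : 0 < r) by apply exp_pos.
  assert (Hra : r < exp (- a)) by (apply exp_increasing; lra).
  assert (Hlnr : ln (1 / r) = a + t).
  { unfold Rdiv; rewrite Rmult_1_l; unfold r; rewrite <- exp_Ropp, ln_exp; ring. }
  apply (radial_comparison w (fun z => (k z * exp (2 * w z) - 1) / (Cmod z ^ 2 * ell z ^ 2))
    (fun s => ln s - ln (s - a)) (fun s => / s - / (s - a))
    (fun s => - / s ^ 2 + / (s - a) ^ 2) r); auto.
  - intros q Hq; apply Hwc; lra.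
  - intros q Hq; apply Hwl; lra.
  - rewrite Hlnr; intros s Hs; auto_derive; [repeat split; lra | field; lra].
  - rewrite Hlnr; intros s Hs; auto_derive; [repeat split; lra | field; lra].
  - intros eps Heps; destruct (Hw eps Heps) as [e [He Hwe]].
    exists (Rmin e r); split; [apply Rmin_pos; lra|]; intros q Hq.
    pose proof (Rmin_l e r); pose proof (Rmin_r e r).
    assert (H1 := Hwe q ltac:(lra)).
    assert (H2 := ell_le q r ltac:(lra)); rewrite Hlnr in H2.
    assert (ln (ell q - a) <= ln (ell q)) by (apply ln_le; lra); lra.
  - intros q Hq; replace (ell q) with (a + t) by (rewrite <- Hlnr, <- Hq; reflexivity).
    replace (a + t - a) with t by ring.
    assert (H1 := HB q ltac:(lra)).
    assert (H2 : ln t <= ln (a * exp (- B))) by (apply ln_le; tauto).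
    rewrite ln_mult, ln_exp in H2 by (try apply exp_pos; lra).
    assert (H3 : ln a <= ln (a + t)) by (apply ln_le; lra); lra.
  - intros q Hq Hqw.
    assert (Hs := ell_lt q r Hq); rewrite Hlnr in Hs.
    replace (Cmod q ^ 2 * ((k q * exp (2 * w q) - 1) / (Cmod q ^ 2 * ell q ^ 2)))
      with ((k q * exp (2 * w q) - 1) / ell q ^ 2) by (field; lra).
    replace (- / ell q ^ 2 + / (ell q - a) ^ 2)
      with ((ell q ^ 2 / (ell q - a) ^ 2 - 1) / ell q ^ 2) by (field; lra).
    apply Rmult_lt_compat_r; [apply Rinv_0_lt_compat; nra|].
    assert (H1 : exp (2 * (ln (ell q) - ln (ell q - a))) < exp (2 * w q))
      by (apply exp_increasing; lra).
    replace (2 * (ln (ell q) - ln (ell q - a))) with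
      (ln (ell q) + ln (ell q) + (- ln (ell q - a) + - ln (ell q - a))) in H1 by ring.
    rewrite !exp_plus, !exp_Ropp, !exp_ln in H1 by lra.
    replace (ell q ^ 2 / (ell q - a) ^ 2)
      with (ell q * ell q * (/ (ell q - a) * / (ell q - a))) by (field; lra).
    assert (H2 := Hk q ltac:(lra)); assert (H3 := exp_pos (2 * w q)); nra.
  - split; [tauto|]; rewrite <- (exp_opp_ell z) by tauto; apply exp_mono; lra. }
intros z Hz; apply Rnot_lt_le; intros Hpos.
assert (He := ell_pos z Hz).
assert (H1 : exp (- (w z / 2)) < 1) by (rewrite <- exp_0; apply exp_increasing; lra).
assert (H2 := exp_pos (- (w z / 2))).
assert (H3 := Hmain z (ell z * (1 - exp (- (w z / 2)))) Hz ltac:(nra)).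
replace (ell z - ell z * (1 - exp (- (w z / 2)))) with (ell z * exp (- (w z / 2))) in H3 by ring.
rewrite ln_mult, ln_exp in H3 by auto; lra.
Qed.

(** * The strong maximum principle *)

Definition sqr_dist (y z : C) : R := (fst z - fst y) ^ 2 + (snd z - snd y) ^ 2.

Lemma continuous_sqr_dist (y z : C) :
  continuous (sqr_dist y) z.
Proof.
apply (continuous_plus (fun q : C => (fst q - fst y) ^ 2) (fun q : C => (snd q - snd y) ^ 2)).
- apply (continuous_real_comp (fun q : C => fst q) (fun t => (t - fst y) ^ 2) (2 * (fst z - fst y))).
  + apply continuous_fst_C.
  + auto_derive; auto; ring.
- apply (continuous_real_comp (fun q : C => snd q) (fun t => (t - snd y) ^ 2) (2 * (snd z - snd y))).
  + apply continuous_snd_C.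
  + auto_derive; auto; ring.
Qed.

Lemma is_laplacian_gaussian (a : R) (y z : C) :
  is_laplacian (fun q => exp (- (a * sqr_dist y q))) z
    ((4 * a ^ 2 * sqr_dist y z - 4 * a) * exp (- (a * sqr_dist y z))).
Proof.
assert (Hline : forall b c t, is_derive2 (fun t => exp (- (a * ((t - b) ^ 2 + c)))) t
   ((4 * a ^ 2 * (t - b) ^ 2 - 2 * a) * exp (- (a * ((t - b) ^ 2 + c))))).
{ intros b c t.
  exists (fun s => - (2 * a * (s - b)) * exp (- (a * ((s - b) ^ 2 + c)))); split.
  - apply filter_forall; intros s; auto_derive; auto; unfold Rminus; simpl; ring.
  - auto_derive; auto; unfold Rminus; simpl; ring. }
eexists; eexists; repeat split.
- apply (Hline (fst y) ((snd z - snd y) ^ 2) (fst z)).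
- apply is_derive2_ext_loc with
    (fun t => exp (- (a * ((t - snd y) ^ 2 + (fst z - fst y) ^ 2)))).
  + apply filter_forall; intros t; unfold sqr_dist; simpl fst; simpl snd.
    now rewrite (Rplus_comm ((t - snd y) ^ 2)).
  + apply (Hline (snd y) ((fst z - fst y) ^ 2) (snd z)).
- unfold sqr_dist; rewrite (Rplus_comm ((snd z - snd y) ^ 2)); ring.
Qed.

(** Hopf's barrier, in the form that spreads strict negativity from the centre of a
    disk to the whole disk: for large [a] the function [exp (- a |z - y|^2)] is
    subharmonic enough, away from the centre, to absorb the zero order term. *)
Lemma negativity_spreads_over_disk (w : C -> R) (y : C) (rho c : R) :
  0 < rho -> 0 <= c ->
  (forall z, sqr_dist y z <= rho ^ 2 -> continuous w z) ->
  (forall z, sqr_dist y z <= rho ^ 2 -> w z <= 0) ->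
  (forall z, sqr_dist y z <= rho ^ 2 -> exists l, is_laplacian w z l /\ c * w z <= l) ->
  w y < 0 ->
  forall z, sqr_dist y z < rho ^ 2 -> w z < 0.
Proof.
intros Hrho Hc Hwc Hw0 Hwl Hy.
assert (Hyy : sqr_dist y y = 0) by (unfold sqr_dist; ring).
set (m := - w y / 2).
assert (Hm : 0 < m) by (unfold m; lra).
assert (Hnear : exists sigma, 0 < sigma < rho ^ 2 /\
   forall z, sqr_dist y z <= sigma -> w z < - m).
{ destruct (continuous_bounded_above_nearby w y (- m)) as [d Hd].
  { apply Hwc; rewrite Hyy; nra. }
  { unfold m; lra. }
  assert (Hdp := cond_pos d).
  set (e := Rmin d rho / 2).
  assert (He : 0 < e /\ e < d /\ e < rho).
  { unfold e; assert (0 < Rmin d rho) by (apply Rmin_pos; lra).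
    pose proof (Rmin_l d rho); pose proof (Rmin_r d rho); lra. }
  exists (e ^ 2); split; [nra|]; intros z Hz; unfold sqr_dist in Hz.
  pose proof (pow2_ge_0 (fst z - fst y)); pose proof (pow2_ge_0 (snd z - snd y)).
  apply Hd; split; [change (Rabs (fst z - fst y) < d) | change (Rabs (snd z - snd y) < d)];
    apply Rle_lt_trans with e; try lra; apply Rabs_le; split; nra. }
destruct Hnear as [sigma [Hsigma Hnear]].
(* chosen so that [4 a^2 |z - y|^2 - 4 a > c] as soon as [|z - y|^2 >= sigma] *)
set (a := 2 / sigma + c + 1).
assert (Hinv : 0 < 2 / sigma) by (apply Rdiv_lt_0_compat; lra).
assert (Has : 2 <= a * sigma).
{ replace 2 with (2 / sigma * sigma) at 1 by (field; lra).
  apply Rmult_le_compat_r; unfold a; lra. }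
assert (Ha : 1 + c <= a) by (unfold a; lra).
set (E := exp (- (a * rho ^ 2))).
set (h := fun z => m * (exp (- (a * sqr_dist y z)) - E)).
assert (HE : 0 < E) by apply exp_pos.
assert (Hbar : forall z, sigma <= sqr_dist y z <= rho ^ 2 -> w z + h z <= 0).
{ apply (weak_maximum_principle _ _ (Rabs (fst y) + Rabs (snd y) + rho)).
  - intros p Hp.
    assert (Hcont := continuous_sqr_dist y p).
    destruct (Rlt_or_le (sqr_dist y p) sigma) as [H|H].
    + generalize (continuous_bounded_above_nearby _ _ _ Hcont H); apply filter_imp.
      intros q Hq; lra.
    + assert (H' : rho ^ 2 < sqr_dist y p) by (apply Rnot_le_lt; tauto).
      generalize (continuous_bounded_below_nearby _ _ _ Hcont H'); apply filter_imp.
      intros q Hq; lra.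
  - intros p [_ Hp]; unfold sqr_dist in Hp.
    pose proof (pow2_ge_0 (fst p - fst y)); pose proof (pow2_ge_0 (snd p - snd y)).
    assert (H1 : Rabs (fst p - fst y) <= rho) by (apply Rabs_le; nra).
    assert (H2 : Rabs (snd p - snd y) <= rho) by (apply Rabs_le; nra).
    pose proof (Rabs_triang (fst p - fst y) (fst y)) as H3.
    pose proof (Rabs_triang (snd p - snd y) (snd y)) as H4.
    replace (fst p - fst y + fst y) with (fst p) in H3 by ring.
    replace (snd p - snd y + snd y) with (snd p) in H4 by ring.
    pose proof (Rabs_pos (fst y)); pose proof (Rabs_pos (snd y)); lra.
  - intros p Hp; apply (continuous_plus w h); [apply Hwc; tauto|].
    apply (continuous_real_comp (sqr_dist y) (fun t => m * (exp (- (a * t)) - E))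
             (- m * a * exp (- (a * sqr_dist y p)))).
    + apply continuous_sqr_dist.
    + auto_derive; auto; ring.
  - intros p Hp Hpos.
    assert (H1 : sqr_dist y p <> sigma).
    { intros H; specialize (Hnear p ltac:(lra)).
      assert (exp (- (a * sqr_dist y p)) <= 1) by (rewrite <- exp_0; apply exp_mono; nra).
      unfold h in Hpos; nra. }
    assert (H2 : sqr_dist y p <> rho ^ 2).
    { intros H; unfold h in Hpos; rewrite H in Hpos; fold E in Hpos.
      specialize (Hw0 p ltac:(lra)); lra. }
    split.
    { assert (Hcont := continuous_sqr_dist y p).
      assert (H3 : sigma < sqr_dist y p) by lra.
      assert (H4 : sqr_dist y p < rho ^ 2) by lra.
      generalize (filter_and _ _ (continuous_bounded_below_nearby _ _ _ Hcont H3)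
                   (continuous_bounded_above_nearby _ _ _ Hcont H4)).
      apply filter_imp; intros q [Hq1 Hq2]; lra. }
    destruct (Hwl p ltac:(tauto)) as [l [Hl Hcl]].
    set (G := exp (- (a * sqr_dist y p))) in *.
    set (D := (4 * a ^ 2 * sqr_dist y p - 4 * a) * G).
    exists (l + m * D); split.
    + apply (is_laplacian_plus w h); auto.
      apply (is_laplacian_scal m (fun q => exp (- (a * sqr_dist y q)) - E)).
      replace D with (D - 0) by ring.
      apply (is_laplacian_minus (fun q => exp (- (a * sqr_dist y q))) (fun _ => E));
        [apply is_laplacian_gaussian | apply is_laplacian_const].
    + assert (HG : 0 < G) by apply exp_pos.
      assert (H5 : - (m * G) < w p) by (unfold h in Hpos; fold G in Hpos; nra).
      assert (H6 : 2 <= a * sqr_dist y p) by nra.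
      assert (H7 : c + 1 <= 4 * a ^ 2 * sqr_dist y p - 4 * a) by nra.
      assert (H8 : (c + 1) * G <= D) by (unfold D; apply Rmult_le_compat_r; lra).
      assert (H9 : m * ((c + 1) * G) <= m * D) by (apply Rmult_le_compat_l; lra).
      assert (H10 : 0 < m * G) by (apply Rmult_lt_0_compat; lra).
      assert (H11 : - (c * (m * G)) <= c * w p) by nra.
      nra. }
intros z Hz.
destruct (Rle_or_lt (sqr_dist y z) sigma) as [H|H].
- specialize (Hnear z H); lra.
- assert (H1 := Hbar z ltac:(lra)).
  assert (E < exp (- (a * sqr_dist y z))) by (apply exp_increasing; nra).
  unfold h in H1; nra.
Qed.

Lemma sqr_dist_Cmod (y z : C) : sqr_dist y z = Cmod (z - y) ^ 2.
Proof.
rewrite Cmod_sqr; destruct y, z; unfold sqr_dist; simpl; ring.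
Qed.

Definition polar (r theta : R) : C := (r * cos theta, r * sin theta).

Lemma Cmod_polar (r theta : R) : 0 <= r -> Cmod (polar r theta) = r.
Proof.
intros Hr; unfold Cmod, polar; simpl fst; simpl snd.
assert (H := sin2_cos2 theta); unfold Rsqr in H.
replace ((r * cos theta) ^ 2 + (r * sin theta) ^ 2) with (r ^ 2) by nra.
now apply sqrt_pow2.
Qed.

Lemma polar_exists (z : C) : 0 < Cmod z -> exists theta, z = polar (Cmod z) theta.
Proof.
intros Hz; destruct z as [x y].
set (r := Cmod (x, y)) in *.
assert (Hr : r ^ 2 = x ^ 2 + y ^ 2) by (unfold r; now rewrite Cmod_sqr).
set (u := x / r).
assert (Hx : x = r * u) by (unfold u; field; lra).
assert (Hu : -1 <= u <= 1).
{ assert (H := proj1 (coordinates_le_Cmod (x, y))); fold r in H; simpl in H.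
  apply Rabs_le_between in H; rewrite Hx in H.
  split; apply Rmult_le_reg_l with r; lra. }
assert (Hs : r * sin (acos u) = Rabs y).
{ rewrite sin_acos by auto.
  rewrite <- (sqrt_pow2 r) at 1 by lra; rewrite <- sqrt_mult_alt by nra.
  rewrite <- sqrt_Rsqr_abs; f_equal; unfold Rsqr; nra. }
destruct (Rle_or_lt 0 y) as [Hy|Hy].
- exists (acos u); unfold polar; rewrite cos_acos, Hs, Rabs_pos_eq, <- Hx by auto; auto.
- exists (- acos u); unfold polar; rewrite cos_neg, sin_neg, cos_acos by auto.
  rewrite Ropp_mult_distr_r_reverse, Hs, Rabs_left, Ropp_involutive, <- Hx by auto; auto.
Qed.

Lemma sqr_dist_polar_le (r theta phi : R) :
  sqr_dist (polar r theta) (polar r phi) <= 2 * (r * (phi - theta)) ^ 2.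
Proof.
assert (Hlip : forall f f', (forall t, derivable_pt_lim f t (f' t)) ->
  (forall t, Rabs (f' t) <= 1) -> (f phi - f theta) ^ 2 <= (phi - theta) ^ 2).
{ intros f f' Hf Hb; destruct (MVT_abs f f' theta phi) as [c [Hc _]]; [auto|].
  rewrite <- (pow2_abs (f phi - f theta)), <- (pow2_abs (phi - theta)), Hc.
  specialize (Hb c); pose proof (Rabs_pos (f' c)); pose proof (Rabs_pos (phi - theta)).
  apply pow_incr; split; nra. }
assert (H1 : (cos phi - cos theta) ^ 2 <= (phi - theta) ^ 2).
{ apply (Hlip cos (fun t => - sin t)).
  - apply derivable_pt_lim_cos.
  - intros t; rewrite Rabs_Ropp; apply Rabs_le, SIN_bound. }
assert (H2 : (sin phi - sin theta) ^ 2 <= (phi - theta) ^ 2).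
{ apply (Hlip sin cos).
  - apply derivable_pt_lim_sin.
  - intros t; apply Rabs_le, COS_bound. }
unfold sqr_dist, polar; simpl fst; simpl snd.
replace ((r * cos phi - r * cos theta) ^ 2 + (r * sin phi - r * sin theta) ^ 2)
  with (r ^ 2 * ((cos phi - cos theta) ^ 2 + (sin phi - sin theta) ^ 2)) by ring.
replace (2 * (r * (phi - theta)) ^ 2) with (r ^ 2 * (2 * (phi - theta) ^ 2)) by ring.
apply Rmult_le_compat_l; [apply pow2_ge_0 | lra].
Qed.

(** The strong maximum principle along a circle: one point of negativity is carried
    round by a chain of disks of a fixed radius [d]. *)
Lemma negativity_spreads_over_circle (w k : C -> R) (z0 : C) :
  (forall z : C, 0 < Cmod z < 1 -> continuous w z) ->
  (forall z : C, 0 < Cmod z < 1 ->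
     is_laplacian w z ((k z * exp (2 * w z) - 1) / (Cmod z ^ 2 * ell z ^ 2))) ->
  (forall z : C, 0 < Cmod z < 1 -> 1 <= k z) ->
  (forall z : C, 0 < Cmod z < 1 -> w z <= 0) ->
  0 < Cmod z0 < 1 -> w z0 < 0 ->
  forall z : C, Cmod z = Cmod z0 -> w z < 0.
Proof.
intros Hwc Hwl Hk Hw0 Hz0 Hneg z Hz.
set (r := Cmod z0) in *.
set (d := Rmin r (1 - r) / 2).
assert (Hd : 0 < d /\ d <= r / 2 /\ d <= (1 - r) / 2).
{ unfold d; assert (0 < Rmin r (1 - r)) by (apply Rmin_pos; lra).
  pose proof (Rmin_l r (1 - r)); pose proof (Rmin_r r (1 - r)); lra. }
assert (Hstep : forall p q : C, Cmod p = r -> w p < 0 -> sqr_dist p q < d ^ 2 -> w q < 0).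
{ intros p q Hp Hwp.
  set (s1 := ln (1 / ((1 + r) / 2))).
  assert (Hs1 : 0 < s1) by (apply ln_inv_pos; lra).
  set (e := (r / 2) ^ 2 * s1 ^ 2).
  assert (He : 0 < e) by (unfold e; apply Rmult_lt_0_compat; nra).
  assert (Hin : forall z, sqr_dist p z <= d ^ 2 -> r / 2 <= Cmod z <= (1 + r) / 2).
  { intros y Hy; rewrite sqr_dist_Cmod in Hy.
    assert (H1 : Cmod (y - p) <= d) by (pose proof (Cmod_ge_0 (y - p)); nra).
    pose proof (Cmod_triangle p (y - p)) as H2.
    pose proof (Cmod_triangle y (- (y - p))) as H3.
    rewrite Cmod_opp in H3.
    replace (p + (y - p))%C with y in H2 by (destruct p, y; unfold Cplus, Cminus, Copp; simpl; f_equal; ring).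
    replace (y + - (y - p))%C with p in H3 by (destruct p, y; unfold Cplus, Cminus, Copp; simpl; f_equal; ring).
    lra. }
  apply (negativity_spreads_over_disk w p d (2 / e)); auto; try lra.
  - left; apply Rdiv_lt_0_compat; lra.
  - intros y Hy; specialize (Hin y Hy); apply Hwc; lra.
  - intros y Hy; specialize (Hin y Hy); apply Hw0; lra.
  - intros y Hy; specialize (Hin y Hy).
    eexists; split; [apply Hwl; lra|].
    assert (H1 := ell_le y ((1 + r) / 2) ltac:(lra)); fold s1 in H1.
    assert (H2 : e <= Cmod y ^ 2 * ell y ^ 2) by (unfold e; apply Rmult_le_compat; nra).
    assert (H3 := Hk y ltac:(lra)); assert (H4 := Hw0 y ltac:(lra)).
    assert (H5 := exp_ineq1_le (2 * w y)); assert (H6 := exp_pos (2 * w y)).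
    apply Rle_trans with (2 * w y / (Cmod y ^ 2 * ell y ^ 2)).
    + assert (/ (Cmod y ^ 2 * ell y ^ 2) <= / e) by (apply Rinv_le_contravar; lra).
      unfold Rdiv; nra.
    + apply Rmult_le_compat_r; [left; apply Rinv_0_lt_compat; lra | nra]. }
destruct (polar_exists z0) as [theta0 Ht0]; [tauto|].
destruct (polar_exists z) as [theta Ht]; [rewrite Hz; tauto|].
fold r in Ht0; rewrite Hz in Ht.
set (eta := d / (2 * r)).
assert (Heta : 0 < eta) by (apply Rdiv_lt_0_compat; lra).
assert (Hchain : forall n phi, Rabs (phi - theta0) <= INR n * eta -> w (polar r phi) < 0).
{ induction n as [|n IH]; intros phi Hphi.
  - simpl in Hphi; rewrite Rmult_0_l in Hphi.
    assert (H : phi - theta0 = 0).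
    { pose proof (Rabs_pos (phi - theta0)); apply Rabs_eq_0; lra. }
    replace phi with theta0 by lra; now rewrite <- Ht0.
  - assert (Hn := pos_INR n); rewrite S_INR in Hphi.
    (* the previous point of the chain, at [n / (n + 1)] of the way from [theta0] *)
    set (psi := theta0 + (phi - theta0) * (INR n / (INR n + 1))).
    assert (H1 : Rabs (phi - theta0) / (INR n + 1) <= eta).
    { apply Rmult_le_reg_r with (INR n + 1); [lra|].
      unfold Rdiv; rewrite Rmult_assoc, Rinv_l; lra. }
    apply (Hstep (polar r psi)).
    + apply Cmod_polar; lra.
    + apply IH; unfold psi.
      replace (theta0 + (phi - theta0) * (INR n / (INR n + 1)) - theta0)
        with ((phi - theta0) * (INR n / (INR n + 1))) by ring.
      assert (H2 : 0 <= INR n / (INR n + 1)).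
      { apply Rmult_le_pos; [lra | left; apply Rinv_0_lt_compat; lra]. }
      rewrite Rabs_mult, (Rabs_pos_eq (INR n / (INR n + 1))) by auto.
      replace (Rabs (phi - theta0) * (INR n / (INR n + 1)))
        with (INR n * (Rabs (phi - theta0) / (INR n + 1))) by (field; lra).
      apply Rmult_le_compat_l; auto.
    + apply Rle_lt_trans with (1 := sqr_dist_polar_le r psi phi).
      assert (H2 : Rabs (phi - psi) <= eta).
      { unfold psi; replace (phi - (theta0 + (phi - theta0) * (INR n / (INR n + 1))))
          with ((phi - theta0) * / (INR n + 1)) by (field; lra).
        assert (0 < / (INR n + 1)) by (apply Rinv_0_lt_compat; lra).
        rewrite Rabs_mult, (Rabs_pos_eq (/ (INR n + 1))) by lra; exact H1. }
      assert (H3 : (phi - psi) ^ 2 <= eta ^ 2).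
      { rewrite <- (pow2_abs (phi - psi)); apply pow_incr; split; [apply Rabs_pos | auto]. }
      assert (H4 : d ^ 2 = 4 * (r ^ 2 * eta ^ 2)) by (unfold eta; field; lra).
      assert (0 < r ^ 2) by nra; assert (0 < eta ^ 2) by nra.
      rewrite Rpow_mult_distr, H4; nra. }
destruct (archimed_cor1 (eta / (1 + Rabs (theta - theta0)))) as [n [Hn1 Hn2]].
{ apply Rdiv_lt_0_compat; [auto | pose proof (Rabs_pos (theta - theta0)); lra]. }
rewrite Ht; apply (Hchain n).
pose proof (Rabs_pos (theta - theta0)) as Hpos.
assert (HN : 0 < INR n) by now apply lt_0_INR.
apply Rmult_lt_compat_r with (r := INR n * (1 + Rabs (theta - theta0))) in Hn1; [|nra].
replace (/ INR n * (INR n * (1 + Rabs (theta - theta0)))) with (1 + Rabs (theta - theta0))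
  in Hn1 by (field; lra).
replace (eta / (1 + Rabs (theta - theta0)) * (INR n * (1 + Rabs (theta - theta0))))
  with (INR n * eta) in Hn1 by (field; lra).
lra.
Qed.

(** * Decay of a negative solution at the puncture *)

(** The Hopf lemma at the puncture: [- A / ell] solves the linearisation of the
    equation, and [k exp (2 w) - 1 >= 2 w] puts every nonpositive [w] that is
    negative on a circle below such a solution, [A] being fitted to the maximum of
    [w] on the circle. *)
Lemma negative_log_ratio_decay (w k : C -> R) (z0 : C) :
  (forall z : C, 0 < Cmod z < 1 -> continuous w z) ->
  (forall z : C, 0 < Cmod z < 1 ->
     is_laplacian w z ((k z * exp (2 * w z) - 1) / (Cmod z ^ 2 * ell z ^ 2))) ->
  (forall z : C, 0 < Cmod z < 1 -> 1 <= k z) ->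
  (forall z : C, 0 < Cmod z < 1 -> w z <= 0) ->
  0 < Cmod z0 < 1 -> w z0 < 0 ->
  exists A, 0 < A /\ forall z : C, 0 < Cmod z <= Cmod z0 -> w z <= - A / ell z.
Proof.
intros Hwc Hwl Hk Hw0 Hz0 Hneg.
set (r := Cmod z0) in *.
destruct (continuous_attains_max_on_annulus r r w) as [p [Hp Hmax]]; [lra| |].
{ intros z Hz; apply Hwc; lra. }
assert (Hwp : w p < 0).
{ apply (negativity_spreads_over_circle w k z0); auto; fold r; lra. }
set (s0 := ln (1 / r)).
assert (Hs0 : 0 < s0) by now apply ln_inv_pos.
set (A := - w p * s0).
assert (HA : 0 < A) by (unfold A; nra).
exists A; split; auto.
apply (radial_comparison w (fun z => (k z * exp (2 * w z) - 1) / (Cmod z ^ 2 * ell z ^ 2))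
  (fun s => - A / s) (fun s => A / s ^ 2) (fun s => - 2 * A / s ^ 3) r).
- tauto.
- intros z Hz; apply Hwc; lra.
- intros z Hz; apply Hwl; lra.
- intros s Hs; fold s0 in Hs; auto_derive; [lra | field; lra].
- intros s Hs; fold s0 in Hs; auto_derive; [nra | field; lra].
- intros eps Heps.
  exists (Rmin r (exp (- (A / eps)))).
  split; [apply Rmin_pos; [tauto | apply exp_pos]|]; intros z Hz.
  pose proof (Rmin_l r (exp (- (A / eps)))); pose proof (Rmin_r r (exp (- (A / eps)))).
  assert (H1 := Hw0 z ltac:(lra)).
  assert (H2 := Cmod_le_of_ell z (A / eps) ltac:(lra)).
  assert (H3 : 0 < A / eps) by (apply Rdiv_lt_0_compat; lra).
  assert (H4 : A / ell z <= eps).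
  { apply Rmult_le_reg_r with (ell z); [lra|].
    unfold Rdiv; rewrite Rmult_assoc, Rinv_l, Rmult_1_r by lra.
    apply Rle_trans with (eps * (A / eps)); [right; field; lra | nra]. }
  unfold Rdiv in *; lra.
- intros z Hz; replace (ell z) with s0 by (unfold ell; rewrite Hz; reflexivity).
  replace (- A / s0) with (w p) by (unfold A; field; lra); apply Hmax; lra.
- intros z Hz Hwz.
  assert (He := ell_pos z ltac:(lra)).
  replace (Cmod z ^ 2 * ((k z * exp (2 * w z) - 1) / (Cmod z ^ 2 * ell z ^ 2)))
    with ((k z * exp (2 * w z) - 1) / ell z ^ 2) by (field; lra).
  replace (- 2 * A / ell z ^ 3) with (2 * (- A / ell z) / ell z ^ 2) by (field; lra).
  apply Rmult_lt_compat_r; [apply Rinv_0_lt_compat; nra|].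
  assert (H1 := Hk z ltac:(lra)).
  assert (H2 := exp_ineq1_le (2 * w z)); assert (H3 := exp_pos (2 * w z)); nra.
Qed.

(** * The theorem *)

Lemma holder_at_origin (kappa : C -> R) :
  locally_holder unit_disk kappa ->
  exists alpha M d, 0 < alpha /\ 0 < d /\
    forall z : C, 0 < Cmod z < d ->
      Rabs (kappa z - kappa (RtoC 0)) <= M * exp (- (alpha * ell z)).
Proof.
intros Hkappa.
assert (H0 : unit_disk (RtoC 0)) by (unfold unit_disk; rewrite Cmod_0; lra).
destruct (Hkappa _ H0) as (alpha & M & d & Ha & Hd & HH).
exists alpha, M, (Rmin d 1); repeat split; [tauto | apply Rmin_pos; lra|].
intros z Hz; pose proof (Rmin_l d 1); pose proof (Rmin_r d 1).
assert (Hz0 : (z - RtoC 0)%C = z).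
{ destruct z; unfold Cminus, Cplus, Copp; simpl; f_equal; ring. }
assert (H00 : (RtoC 0 - RtoC 0)%C = RtoC 0).
{ unfold Cminus, Cplus, Copp; simpl; unfold RtoC; f_equal; ring. }
assert (HM := HH z (RtoC 0)).
rewrite Hz0, H00, Cmod_0 in HM.
replace (- (alpha * ell z)) with (alpha * ln (Cmod z)) by (rewrite ell_opp_ln by tauto; ring).
apply HM; auto; try lra.
- unfold unit_disk; lra.
- intros Heq; rewrite Heq, Cmod_0 in Hz; lra.
Qed.

Lemma exp_opp_ell_small (M alpha eps : R) :
  0 < alpha -> 0 < eps -> exists eta, 0 < eta < 1 /\
    forall z : C, 0 < Cmod z <= eta -> M * exp (- (alpha * ell z)) <= eps.
Proof.
intros Ha Heps.
set (s := 1 + (Rabs M / eps) / alpha).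
assert (Hq : 0 <= Rabs M / eps).
{ apply Rmult_le_pos; [apply Rabs_pos | left; now apply Rinv_0_lt_compat]. }
assert (Hs : 1 <= s).
{ assert (0 <= Rabs M / eps / alpha); [|unfold s; lra].
  apply Rmult_le_pos; [auto | left; now apply Rinv_0_lt_compat]. }
exists (exp (- s)); split.
{ split; [apply exp_pos | rewrite <- exp_0; apply exp_increasing; lra]. }
intros z Hz; assert (He := Cmod_le_of_ell z s Hz).
set (x := alpha * ell z).
assert (Hx : Rabs M / eps <= x).
{ apply Rle_trans with (alpha * s); [|apply Rmult_le_compat_l; lra].
  unfold s; replace (alpha * (1 + Rabs M / eps / alpha)) with (alpha + Rabs M / eps)
    by (field; lra); lra. }
assert (Hp : exp x * exp (- x) = 1) by (rewrite <- exp_plus, Rplus_opp_r; apply exp_0).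
assert (H1 := exp_ineq1_le x); assert (H2 := exp_pos (- x)); assert (H3 := Rle_abs M).
assert (H4 : Rabs M <= eps * exp x).
{ apply Rle_trans with (eps * (Rabs M / eps)); [right; field; lra|].
  apply Rmult_le_compat_l; lra. }
apply Rle_trans with (eps * exp x * exp (- x)); [nra|].
rewrite Rmult_assoc, Hp; lra.
Qed.

Lemma log_ratio_limit_along_sequence (w : C -> R) (c : R) (zn : nat -> C) :
  (forall eps, 0 < eps -> exists eta, 0 < eta < 1 /\
     forall z : C, 0 < Cmod z <= eta -> Rabs (w z - c) <= eps) ->
  (forall n, punctured_disk (zn n)) ->
  (forall eta, 0 < eta -> eventually (fun n => Cmod (zn n) <= eta)) ->
  (forall eps, 0 < eps -> eventually (fun n => Rabs (w (zn n)) <= eps / ell (zn n))) ->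
  c = 0.
Proof.
intros Hw Hzn Hto0 Hsmall.
destruct (Req_dec c 0) as [Hc|Hc]; auto; exfalso.
assert (Hcp : 0 < Rabs c) by now apply Rabs_pos_lt.
destruct (Hw (Rabs c / 3)) as [eta [Heta Hw']]; [lra|].
destruct (filter_and _ _ (Hto0 eta (proj1 Heta))
  (filter_and _ _ (Hto0 (exp (- (1))) (exp_pos _)) (Hsmall (Rabs c / 3) ltac:(lra)))) as [N HN].
destruct (HN N (le_n N)) as [H1 [H2 H3]].
assert (Hz := proj1 (punctured_disk_Cmod _) (Hzn N)).
assert (H4 := Hw' (zn N) ltac:(lra)).
assert (H5 := Cmod_le_of_ell (zn N) 1 ltac:(lra)).
assert (H6 : Rabs c / 3 / ell (zn N) <= Rabs c / 3).
{ apply Rmult_le_reg_r with (ell (zn N)); [lra|].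
  replace (Rabs c / 3 / ell (zn N) * ell (zn N)) with (Rabs c / 3) by (field; lra); nra. }
pose proof (Rabs_triang (w (zn N)) (- (w (zn N) - c))) as H7.
rewrite Rabs_Ropp in H7.
replace (w (zn N) + - (w (zn N) - c)) with c in H7 by ring; lra.
Qed.

Lemma filterlim_0_Cmod (zn : nat -> C) :
  filterlim zn eventually (locally (RtoC 0)) ->
  forall eta, 0 < eta -> eventually (fun n => Cmod (zn n) <= eta).
Proof.
intros Hlim eta Heta.
assert (H : locally (RtoC 0) (fun z : C => Cmod z < eta)).
{ apply (continuous_bounded_above_nearby (fun z => Cmod z)).
  - apply continuous_Cmod.
  - now rewrite Cmod_0. }
assert (H' : eventually (fun n => Cmod (zn n) < eta)) by exact (Hlim _ H).
revert H'; apply filter_imp; intros n Hn; lra.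
Qed.

Theorem theorem2p4 (kappa lambda : C -> R)
  (Hkappa : locally_holder unit_disk kappa)
  (Hlambda : conformal_metric punctured_disk lambda)
  (Hsing : singularity_of_order_1 lambda)
  (Hcurv : forall z : C, punctured_disk z -> gauss_curvature lambda z = kappa z) :
  (kappa (RtoC 0) = -4 ->
   is_bigO (locally' (RtoC 0))
     (fun z : C => ln (lambda z) - ln (hyperbolic_punctured_disk z))
     (fun z : C => 1 / ln (1 / Cmod z)))
  /\
  ((forall z : C, punctured_disk z -> gauss_curvature lambda z <= -4) ->
   forall zn : nat -> C,
   (forall n : nat, punctured_disk (zn n)) ->
   filterlim zn eventually (locally (RtoC 0)) ->
   is_littleo eventually
     (fun n : nat => ln (lambda (zn n)) - ln (hyperbolic_punctured_disk (zn n)))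
     (fun n : nat => 1 / ln (1 / Cmod (zn n))) ->
   forall z : C, punctured_disk z -> lambda z = hyperbolic_punctured_disk z).
Proof.
set (w := log_ratio lambda); set (k := fun z => - kappa z / 4).
assert (Hwc : forall z : C, 0 < Cmod z < 1 -> continuous w z).
{ intros z Hz; apply continuous_log_ratio; auto; now apply punctured_disk_Cmod. }
assert (Hwl : forall z : C, 0 < Cmod z < 1 ->
  is_laplacian w z ((k z * exp (2 * w z) - 1) / (Cmod z ^ 2 * ell z ^ 2))).
{ intros z Hz; apply punctured_disk_Cmod in Hz; unfold k; rewrite <- Hcurv by auto.
  now apply log_ratio_equation. }
destruct (log_ratio_limit lambda Hsing) as [c Hlim]; fold w in Hlim.
assert (Hlim0 : c = 0 -> forall eps, 0 < eps -> exists eta, 0 < eta < 1 /\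
  forall z : C, 0 < Cmod z <= eta -> Rabs (w z) <= eps).
{ intros Hc eps Heps; destruct (Hlim eps Heps) as [eta [Heta H]].
  exists eta; split; auto; intros z Hz; specialize (H z Hz).
  now rewrite Hc, Rminus_0_r in H. }
split.
- intros Hk0.
  destruct (holder_at_origin kappa Hkappa) as (alpha & M & d & Ha & Hd & HM).
  assert (Hk : forall z : C, 0 < Cmod z < d ->
    Rabs (k z - 1) <= M * exp (- (alpha * ell z))).
  { intros z Hz; apply Rle_trans with (2 := HM z Hz); rewrite Hk0; unfold k.
    replace (- kappa z / 4 - 1) with (- (1 / 4 * (kappa z - -4))) by field.
    rewrite Rabs_Ropp, Rabs_mult, (Rabs_pos_eq (1 / 4)) by lra.
    pose proof (Rabs_pos (kappa z - -4)); lra. }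
  assert (Hc : c = 0).
  { apply (limit_is_zero w k c); auto.
    intros eps Heps; destruct (exp_opp_ell_small M alpha eps Ha Heps) as [eta [Heta H]].
    pose proof (Rmin_l eta (d / 2)); pose proof (Rmin_r eta (d / 2)).
    assert (0 < Rmin eta (d / 2)) by (apply Rmin_pos; lra).
    exists (Rmin eta (d / 2)); split; [lra|]; intros z Hz.
    apply Rle_trans with (1 := Hk z ltac:(lra)); apply H; lra. }
  destruct (decay_of_log_ratio w k M alpha d) as (A & r & Hr & HA); auto.
  exists A; unfold locally', within.
  assert (H0 : Cmod (RtoC 0) < r) by (rewrite Cmod_0; lra).
  generalize (continuous_bounded_above_nearby (fun z => Cmod z) (RtoC 0) r
                (continuous_Cmod _) H0).
  apply filter_imp; intros z Hz Hz0.
  assert (Hz' : 0 < Cmod z) by now apply Cmod_gt_0.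
  assert (He := ell_pos z ltac:(lra)).
  fold (ell z); rewrite (Rabs_pos_eq (1 / ell z)) by (left; apply Rdiv_lt_0_compat; lra).
  replace (A * (1 / ell z)) with (A / ell z) by (field; lra).
  apply HA; lra.
- intros Hk4 zn Hzn Hto0 Hsmall.
  assert (Hk : forall z : C, 0 < Cmod z < 1 -> 1 <= k z).
  { intros z Hz; apply punctured_disk_Cmod in Hz.
    specialize (Hk4 z Hz); rewrite Hcurv in Hk4 by auto; unfold k; lra. }
  assert (Hcmod := filterlim_0_Cmod zn Hto0).
  assert (Hsm : forall eps, 0 < eps ->
    eventually (fun n => Rabs (w (zn n)) <= eps / ell (zn n))).
  { intros eps Heps; generalize (Hsmall (mkposreal eps Heps)); apply filter_imp.
    intros n Hn; apply Rle_trans with (1 := Hn).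
    assert (He := ell_pos _ (proj1 (punctured_disk_Cmod _) (Hzn n))).
    change (eps * Rabs (1 / ell (zn n)) <= eps / ell (zn n)).
    rewrite Rabs_pos_eq by (left; apply Rdiv_lt_0_compat; lra).
    right; field; lra. }
  assert (Hc := log_ratio_limit_along_sequence w c zn Hlim Hzn Hcmod Hsm).
  assert (Hneg : forall z : C, 0 < Cmod z < 1 -> w z <= 0).
  { apply (log_ratio_nonpositive w k); auto.
    intros eps Heps; destruct (Hlim0 Hc eps Heps) as [eta [Heta H]].
    exists eta; split; auto; intros z Hz.
    apply Rle_trans with (1 := Rle_abs _); auto. }
  intros z Hz; assert (Hz' := proj1 (punctured_disk_Cmod z) Hz).
  destruct (Rle_lt_or_eq_dec _ _ (Hneg z Hz')) as [Hlt|Heq].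
  + exfalso.
    destruct (negative_log_ratio_decay w k z) as [A [HA Hdecay]]; auto.
    destruct (filter_and _ _ (Hcmod (Cmod z) (proj1 Hz')) (Hsm (A / 2) ltac:(lra)))
      as [N HN].
    destruct (HN N (le_n N)) as [H1 H2].
    assert (Hz2 := proj1 (punctured_disk_Cmod _) (Hzn N)).
    assert (He := ell_pos _ Hz2).
    assert (H3 := Hdecay (zn N) ltac:(lra)).
    apply Rabs_le_between in H2.
    assert (0 < A / 2 / ell (zn N)) by (apply Rdiv_lt_0_compat; lra).
    replace (- A / ell (zn N)) with (- 2 * (A / 2 / ell (zn N))) in H3 by (field; lra).
    lra.
  + unfold w, log_ratio in Heq.
    apply ln_inv; [now apply Hlambda | now apply hyperbolic_pos | lra].
Qed.
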